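(* Let $P\colon \mathcal{C}^{\mathrm{op}}\to \mathsf{InfSl}$ be an $\exists$-supercompactifiable tripos (i.e. a full tripos that is $\exists$-supercompactifiable), and let $P^{\exists}$ be its full existential completion. Then: 1. there is a geometric embedding of triposes $P\hookrightarrow P^{\exists}$; 2. there is a geometric embedding of toposes $\mathsf{T}_P\hookrightarrow \mathsf{T}_{P^{\exists}}$.
   Context: A lex primary doctrine is a functor $P\colon \mathcal{C}^{\mathrm{op}}\to\mathsf{InfSl}$, where $\mathcal{C}$ has finite limits and $\mathsf{InfSl}$ is the category of inf-semilattices (posets with finite meets, including top) and their homomorphisms. For $f\colon A\to B$ write $P_f\colon P(B)\to P(A)$. $P$ is full existential if for every arrow $f$ of $\mathcal{C}$ the map $P_f$ has a left adjoint $\exists_f$, satisfying Beck–Chevalley (for pullback squares) and Frobenius reciprocity. $P$ is a full first-order hyperdoctrine if it is full existential, each $P(A)$ is a Heyting algebra, each $P_f$ is a Heyting algebra homomorphism, and each $P_f$ also has a right adjoint $\forall_f$, these satisfying Beck–Chevalley. $P$ has weak power objects if for every object $X$ there are an object $\mathrm{P}X$ and $\in_X\in P(X\times\mathrm{P}X)$ such that for every $Y$ and $\beta\in P(X\times Y)$ there is an arrow $\{\beta\}_X\colon Y\to\mathrm{P}X$ with $\beta=P_{\mathrm{id}_X\times\{\beta\}_X}(\in_X)$. A full tripos is a full first-order hyperdoctrine with weak power objects. Category of points $\mathcal{G}_P$: objects are pairs $(A,\alpha)$ with $\alpha\in P(A)$; arrows $(A,\alpha)\to(B,\beta)$ are arrows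 $f\colon A\to B$ of $\mathcal{C}$ with $\alpha\le P_f(\beta)$. It has finite limits. Weak dependent products: a weak dependent product of $f\colon X\to J$ along $g\colon J\to I$ consists of an arrow $h\colon Z\to I$ and an arrow $e\colon E\to X$, where $E$ is the pullback of $g$ and $h$, such that $fe$ is the projection $E\to J$, and such that for any other such data $h'\colon Z'\to I$, $e'\colon E'\to X$ (with $E'$ the pullback of $g$ and $h'$, and $fe'$ the projection $E'\to J$) there is $w\colon Z'\to Z$ with $h'=hw$ and $e'=ek$, where $k\colon E'\to E$ is induced by $w$. Generic proof: an arrow $\theta\colon\Theta\to\Lambda$ such that for every arrow $f\colon Y\to X$ there is $\upsilon_f\colon X\to\Lambda$ such that $f$ factors through the pullback $\upsilon_f^*\theta$ of $\theta$ along $\upsilon_f$ and $\upsilon_f^*\theta$ factors through $f$. A lex primary doctrine $P$ is $\exists$-supercompactifiable if $\mathcal{G}_P$ has weak dependent products (for all composable pairs) and a generic proof. It is known (and part of the paper) that in this case $P^\exists$ is a full tripos. Full existential completion $P^{\exists}$: $P^{\exists}(A)$ is the poset reflection of the preorder of pairs $(B\xrightarrow{f}A,\alpha)$ with $\alpha\in P(B)$, where $(B\xrightarrow{f}A,\alpha)\le(C\xrightarrow{g}A,\beta)$ iff there is $h\colon B\to C$ with $f=gh$ and $\alpha\le P_h(\beta)$; for $f\colon A\to B$, $P^{\exists}_f(C\xrightarrow{g}B,\beta):=(D\xrightarrow{f^*g}A,P_{g^*f}(\beta))$, with $D$ the pullback of $f$ and $g$ and projections $f^*g\colon D\to A$,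 $g^*f\colon D\to C$. 2-category of lex primary doctrines: a lex primary morphism $(F,\mathfrak{b})\colon P\to R$, for $P$ on $\mathcal{C}$ and $R$ on $\mathcal{D}$, is a finite-limit-preserving functor $F\colon\mathcal{C}\to\mathcal{D}$ with a natural transformation $\mathfrak{b}\colon P\to R\circ F^{\mathrm{op}}$ (components in $\mathsf{InfSl}$); a 2-cell $(F,\mathfrak{b})\Rightarrow(G,\mathfrak{c})$ is a natural transformation $\theta\colon F\to G$ with $\mathfrak{b}_A(\alpha)\le R_{\theta_A}(\mathfrak{c}_A(\alpha))$ for all $\alpha\in P(A)$. A geometric morphism of triposes $P\to R$ is a lex primary morphism $P\to R$ that has a left adjoint (in this 2-category); it is a geometric embedding if the counit of the adjunction is an isomorphism. Tripos-to-topos construction $\mathsf{T}_R$ of a full existential doctrine $R$: objects are pairs $(A,\rho)$ with $\rho\in R(A\times A)$ such that $\rho\le R_{\langle\pi_2,\pi_1\rangle}(\rho)$ and $R_{\langle\pi_1,\pi_2\rangle}(\rho)\wedge R_{\langle\pi_2,\pi_3\rangle}(\rho)\le R_{\langle\pi_1,\pi_3\rangle}(\rho)$. Arrows $(A,\rho)\to(B,\sigma)$ are $\phi\in R(A\times B)$ such that: (i) $\phi\le R_{\langle\pi_1,\pi_1\rangle}(\rho)\wedge R_{\langle\pi_2,\pi_2\rangle}(\sigma)$; (ii) $R_{\langle\pi_1,\pi_2\rangle}(\rho)\wedge R_{\langle\pi_1,\pi_3\rangle}(\phi)\le R_{\langle\pi_2,\pi_3\rangle}(\phi)$ over $A\times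 A\times B$; (iii) $R_{\langle\pi_2,\pi_3\rangle}(\sigma)\wedge R_{\langle\pi_1,\pi_2\rangle}(\phi)\le R_{\langle\pi_1,\pi_3\rangle}(\phi)$ over $A\times B\times B$; (iv) $R_{\langle\pi_1,\pi_2\rangle}(\phi)\wedge R_{\langle\pi_1,\pi_3\rangle}(\phi)\le R_{\langle\pi_2,\pi_3\rangle}(\sigma)$ over $A\times B\times B$; (v) $R_{\Delta_A}(\rho)\le\exists_{\pi_1}(\phi)$, with $\pi_1\colon A\times B\to A$. Composition is relational composition and the identity of $(A,\rho)$ is $\rho$. If $R$ is a full tripos then $\mathsf{T}_R$ is an elementary topos. A geometric embedding of toposes is a geometric morphism whose counit is an isomorphism (equivalently, whose direct image is full and faithful). *)

(* Defs.v *)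
From Stdlib Require Import ssreflect ProofIrrelevance PropExtensionality
  FunctionalExtensionality IndefiniteDescription.

Set Implicit Arguments.
Unset Strict Implicit.
Unset Printing Implicit Defensive.

(** * Categories and finite limits *)

Record Category : Type := MkCategory {
  Ob :> Type;
  Hom : Ob -> Ob -> Type;
  idm : forall A, Hom A A;
  comp : forall A B C, Hom B C -> Hom A B -> Hom A C;
  comp_idl : forall A B (f : Hom A B), comp (idm B) f = f;
  comp_idr : forall A B (f : Hom A B), comp f (idm A) = f;
  comp_assoc : forall A B C D (h : Hom C D) (g : Hom B C) (f : Hom A B),
    comp h (comp g f) = comp (comp h g) f
}.

Arguments Hom {_} _ _.
Arguments idm {_} _.
Arguments comp {_ _ _ _} _ _.

Declare Scope cat_scope.
Delimit Scope cat_scope with cat.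
Open Scope cat_scope.
Notation "g ∘ f" := (comp g f) (at level 40, left associativity) : cat_scope.

Definition is_iso (C : Category) (A B : C) (f : Hom A B) : Prop :=
  exists g : Hom B A, g ∘ f = idm A /\ f ∘ g = idm B.

Definition is_mono (C : Category) (A B : C) (m : Hom A B) : Prop :=
  forall (X : C) (u v : Hom X A), m ∘ u = m ∘ v -> u = v.

Definition is_terminal (C : Category) (T : C) : Prop :=
  forall A : C, exists! f : Hom A T, True.

(** The square with sides [p : D -> A], [q : D -> B] over the cospan
    [f : A -> X], [g : B -> X] is a pullback. *)
Definition is_pullback (C : Category) (A B X : C) (f : Hom A X) (g : Hom B X)
    (D : C) (p : Hom D A) (q : Hom D B) : Prop :=
  f ∘ p = g ∘ q /\
  forall (Z : C) (a : Hom Z A) (b : Hom Z B), f ∘ a = g ∘ b ->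
    exists! h : Hom Z D, p ∘ h = a /\ q ∘ h = b.

(** A choice of finite limits.  Binary products are determined up to isomorphism
    by the other two; they are chosen separately because the fibres over them
    are mentioned everywhere. *)
Record FinLimits (C : Category) : Type := MkFinLimits {
  one : C;
  one_terminal : is_terminal one;
  prd : C -> C -> C;
  pr1 : forall A B, Hom (prd A B) A;
  pr2 : forall A B, Hom (prd A B) B;
  pair : forall X A B, Hom X A -> Hom X B -> Hom X (prd A B);
  pair_pr1 : forall X A B (f : Hom X A) (g : Hom X B), pr1 A B ∘ pair f g = f;
  pair_pr2 : forall X A B (f : Hom X A) (g : Hom X B), pr2 A B ∘ pair f g = g;
  pair_eta : forall X A B (h : Hom X (prd A B)),
    pair (pr1 A B ∘ h) (pr2 A B ∘ h) = h;
  pb : forall A B X (f : Hom A X) (g : Hom B X), C;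
  pb1 : forall A B X (f : Hom A X) (g : Hom B X), Hom (pb f g) A;
  pb2 : forall A B X (f : Hom A X) (g : Hom B X), Hom (pb f g) B;
  pb_pullback : forall A B X (f : Hom A X) (g : Hom B X),
    is_pullback f g (pb1 f g) (pb2 f g)
}.

Arguments pair_eta {C} _ {X A B} _.
Arguments pb_pullback {C} _ {A B X} _ _.

Record Functor (C D : Category) : Type := MkFunctor {
  fob :> C -> D;
  fmap : forall A B, Hom A B -> Hom (fob A) (fob B);
  fmap_id : forall A, fmap (idm A) = idm (fob A);
  fmap_comp : forall A B X (g : Hom B X) (f : Hom A B),
    fmap (g ∘ f) = fmap g ∘ fmap f
}.
Arguments fmap {C D} _ {A B} _.

Definition functor_id (C : Category) : Functor C C.
Proof. by apply: (@MkFunctor C C (fun A => A) (fun A B f => f)). Defined.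

Definition functor_comp (C D E : Category) (G : Functor D E) (F : Functor C D) :
  Functor C E.
Proof.
apply: (@MkFunctor C E (fun A => G (F A)) (fun A B f => fmap G (fmap F f))).
- by move=> A; rewrite !fmap_id.
- by move=> A B X g f; rewrite !fmap_comp.
Defined.

(** Preservation of the terminal object and of pullbacks, hence of all finite
    limits. *)
Definition preserves_finite_limits (C D : Category) (F : Functor C D) : Prop :=
  (forall T : C, is_terminal T -> is_terminal (F T)) /\
  (forall (A B X : C) (f : Hom A X) (g : Hom B X) (Q : C)
      (p : Hom Q A) (q : Hom Q B),
    is_pullback f g p q ->
    is_pullback (fmap F f) (fmap F g) (fmap F p) (fmap F q)).

Record NatTrans (C D : Category) (F G : Functor C D) : Type := MkNatTrans {
  nt :> forall A : C, Hom (F A) (G A);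
  nt_nat : forall (A B : C) (f : Hom A B), nt B ∘ fmap F f = fmap G f ∘ nt A
}.

(** ** Elementary toposes and their geometric morphisms *)

(** Every [X] has a power object: a mono [m : E -> X × PX] of which every mono
    [r : S -> X × Y] is the pullback along [id × c] for a unique [c : Y -> PX]. *)
Definition has_power_objects (C : Category) (L : FinLimits C) : Prop :=
  forall X : C, exists (PX E : C) (m : Hom E (prd L X PX)), is_mono m /\
    forall (Y S : C) (r : Hom S (prd L X Y)), is_mono r ->
      exists! c : Hom Y PX, exists s : Hom S E,
        is_pullback m (pair L (pr1 L X Y) (c ∘ pr2 L X Y)) s r.

Definition is_elementary_topos (C : Category) : Prop :=
  exists L : FinLimits C, has_power_objects L.

Record Topos : Type := MkTopos {
  topos_cat :> Category;
  topos_axiom : is_elementary_topos topos_cat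
}.

Record ToposGeometricMorphism (E F : Topos) : Type := MkToposGeometricMorphism {
  t_direct : Functor E F;
  t_inverse : Functor F E;
  t_inverse_lex : preserves_finite_limits t_inverse;
  t_unit : NatTrans (functor_id F) (functor_comp t_direct t_inverse);
  t_counit : NatTrans (functor_comp t_inverse t_direct) (functor_id E);
  t_triangle_inverse : forall Y : F,
    t_counit (t_inverse Y) ∘ fmap t_inverse (t_unit Y) = idm (t_inverse Y);
  t_triangle_direct : forall X : E,
    fmap t_direct (t_counit X) ∘ t_unit (t_direct X) = idm (t_direct X)
}.

Definition is_topos_embedding (E F : Topos) (g : ToposGeometricMorphism E F) :
    Prop :=
  forall X : E, is_iso (t_counit g X).

(** * Inf-semilattices and lex primary doctrines *)

Record InfSl : Type := MkInfSl {
  car :> Type;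
  le : car -> car -> Prop;
  le_refl : forall x, le x x;
  le_trans : forall x y z, le x y -> le y z -> le x z;
  le_antisym : forall x y, le x y -> le y x -> x = y;
  top : car;
  le_top : forall x, le x top;
  meet : car -> car -> car;
  le_meet : forall z x y, le z (meet x y) <-> le z x /\ le z y
}.

Arguments le {_} _ _.
Arguments top {_}.
Arguments meet {_} _ _.

Notation "x ⊑ y" := (le x y) (at level 70, no associativity) : cat_scope.
Notation "x ⊓ y" := (meet x y) (at level 50, left associativity) : cat_scope.

Record LexDoctrine : Type := MkLexDoctrine {
  base :> Category;
  lim : FinLimits base;
  fib : base -> InfSl;
  rx : forall A B : base, Hom A B -> fib B -> fib A;
  rx_top : forall (A B : base) (f : Hom A B), rx f top = top;
  rx_meet : forall (A B : base) (f : Hom A B) (x y : fib B),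
    rx f (x ⊓ y) = rx f x ⊓ rx f y;
  rx_id : forall (A : base) (x : fib A), rx (idm A) x = x;
  rx_comp : forall (A B C : base) (g : Hom B C) (f : Hom A B) (x : fib C),
    rx (g ∘ f) x = rx f (rx g x)
}.
Arguments fib : clear implicits.
Arguments rx {_ _ _} _ _.
Arguments lim : clear implicits.

(** Chosen products in the base of the doctrine [P]. *)
Notation "A ×[ P ] B" := (prd (lim P) A B)
  (at level 40, left associativity, format "A  ×[ P ]  B") : cat_scope.
Notation "⟨ f , g ⟩" := (pair (lim _) f g) (at level 0, format "⟨ f ,  g ⟩") :
  cat_scope.
Notation "'π1'" := (pr1 (lim _) _ _) (at level 0) : cat_scope.
Notation "'π2'" := (pr2 (lim _) _ _) (at level 0) : cat_scope.

(** ** The 2-category of lex primary doctrines *)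

Record LexDoctrineMor (P R : LexDoctrine) : Type := MkLexDoctrineMor {
  dm_fun : Functor P R;
  dm_lex : preserves_finite_limits dm_fun;
  dm_map : forall A : P, fib P A -> fib R (dm_fun A);
  dm_top : forall A : P, dm_map (top : fib P A) = top;
  dm_meet : forall (A : P) (x y : fib P A),
    dm_map (x ⊓ y) = dm_map x ⊓ dm_map y;
  dm_nat : forall (A B : P) (f : Hom A B) (x : fib P B),
    dm_map (rx f x) = rx (fmap dm_fun f) (dm_map x)
}.
Arguments dm_map {P R} _ {A} _.

Definition doctrine_id (P : LexDoctrine) : LexDoctrineMor P P.
Proof. by apply: (@MkLexDoctrineMor P P (functor_id P) _ (fun A x => x)). Defined.

Definition doctrine_comp (P Q R : LexDoctrine) (G : LexDoctrineMor Q R)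
    (F : LexDoctrineMor P Q) : LexDoctrineMor P R.
Proof.
apply: (@MkLexDoctrineMor P R (functor_comp (dm_fun G) (dm_fun F)) _
          (fun A x => dm_map G (dm_map F x))).
- have [hF1 hF2] := dm_lex F; have [hG1 hG2] := dm_lex G.
  split=> [T hT|A B X f g D p q h]; first exact/hG1/hF1.
  exact/hG2/hF2.
- by move=> A; rewrite !dm_top.
- by move=> A x y; rewrite !dm_meet.
- by move=> A B f x; rewrite !dm_nat.
Defined.

Record TwoCell (P R : LexDoctrine) (F G : LexDoctrineMor P R) : Type := MkTwoCell {
  tc_nt :> NatTrans (dm_fun F) (dm_fun G);
  tc_le : forall (A : P) (x : fib P A), dm_map F x ⊑ rx (tc_nt A) (dm_map G x)
}.

Definition is_invertible_2cell (P R : LexDoctrine) (F G : LexDoctrineMor P R)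
    (t : TwoCell F G) : Prop :=
  exists s : TwoCell G F,
    (forall A : P, s A ∘ t A = idm (dm_fun F A)) /\
    (forall A : P, t A ∘ s A = idm (dm_fun G A)).

(** 2-cells compose and are whiskered as their underlying natural
    transformations, so the triangle identities are those of the functors. *)
Record DoctrineAdjunction (P R : LexDoctrine) (L : LexDoctrineMor R P)
    (G : LexDoctrineMor P R) : Type := MkDoctrineAdjunction {
  d_unit : TwoCell (doctrine_id R) (doctrine_comp G L);
  d_counit : TwoCell (doctrine_comp L G) (doctrine_id P);
  d_triangle_left : forall B : R,
    d_counit (dm_fun L B) ∘ fmap (dm_fun L) (d_unit B) = idm (dm_fun L B);
  d_triangle_right : forall A : P,
    fmap (dm_fun G) (d_counit A) ∘ d_unit (dm_fun G A) = idm (dm_fun G A)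
}.

(** ** Full existential doctrines, first-order hyperdoctrines and triposes *)

Record FullExistential (P : LexDoctrine) : Type := MkFullExistential {
  ex : forall A B : P, Hom A B -> fib P A -> fib P B;
  ex_adj : forall (A B : P) (f : Hom A B) (x : fib P A) (y : fib P B),
    ex f x ⊑ y <-> x ⊑ rx f y;
  ex_beck_chevalley : forall (A B X : P) (f : Hom A X) (g : Hom B X) (D : P)
      (p : Hom D A) (q : Hom D B), is_pullback f g p q ->
    forall x : fib P A, rx g (ex f x) = ex q (rx p x);
  ex_frobenius : forall (A B : P) (f : Hom A B) (x : fib P A) (y : fib P B),
    ex f (x ⊓ rx f y) = ex f x ⊓ y
}.
Arguments ex {P} _ {A B} _ _.

Record HeytingStructure (H : InfSl) : Type := MkHeytingStructure {
  bot : H;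
  bot_le : forall x : H, bot ⊑ x;
  join : H -> H -> H;
  join_le : forall x y z : H, join x y ⊑ z <-> x ⊑ z /\ y ⊑ z;
  imp : H -> H -> H;
  le_imp : forall x y z : H, z ⊑ imp x y <-> z ⊓ x ⊑ y
}.

Record FullFirstOrder (P : LexDoctrine) : Type := MkFullFirstOrder {
  fo_ex : FullExistential P;
  fo_heyting : forall A : P, HeytingStructure (fib P A);
  rx_bot : forall (A B : P) (f : Hom A B),
    rx f (bot (fo_heyting B)) = bot (fo_heyting A);
  rx_join : forall (A B : P) (f : Hom A B) (x y : fib P B),
    rx f (join (fo_heyting B) x y) = join (fo_heyting A) (rx f x) (rx f y);
  rx_imp : forall (A B : P) (f : Hom A B) (x y : fib P B),
    rx f (imp (fo_heyting B) x y) = imp (fo_heyting A) (rx f x) (rx f y);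
  all : forall A B : P, Hom A B -> fib P A -> fib P B;
  all_adj : forall (A B : P) (f : Hom A B) (x : fib P A) (y : fib P B),
    y ⊑ all f x <-> rx f y ⊑ x;
  all_beck_chevalley : forall (A B X : P) (f : Hom A X) (g : Hom B X) (D : P)
      (p : Hom D A) (q : Hom D B), is_pullback f g p q ->
    forall x : fib P A, rx g (all f x) = all q (rx p x)
}.

Definition has_weak_power_objects (P : LexDoctrine) : Prop :=
  forall X : P, exists (PX : P) (inX : fib P (X ×[P] PX)),
    forall (Y : P) (b : fib P (X ×[P] Y)),
      exists c : Hom Y PX, b = rx ⟨π1, c ∘ π2⟩ inX.

Record FullTripos (P : LexDoctrine) : Type := MkFullTripos {
  ft_fo : FullFirstOrder P;
  ft_weak_power : has_weak_power_objects P
}.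

Record Tripos : Type := MkTripos {
  tripos_doctrine :> LexDoctrine;
  tripos_axiom : FullTripos tripos_doctrine
}.

Definition tripos_ex (T : Tripos) : FullExistential T :=
  fo_ex (ft_fo (tripos_axiom T)).

Record TriposGeometricMorphism (P R : Tripos) : Type :=
  MkTriposGeometricMorphism {
    d_direct : LexDoctrineMor P R;
    d_inverse : LexDoctrineMor R P;
    d_adj : DoctrineAdjunction d_inverse d_direct
  }.

Definition is_tripos_embedding (P R : Tripos) (g : TriposGeometricMorphism P R) :
    Prop :=
  is_invertible_2cell (d_counit (d_adj g)).

(** * Basic facts on doctrines *)

Section Facts.
Variable P : LexDoctrine.

Lemma meet_lel (H : InfSl) (x y : H) : x ⊓ y ⊑ x.
Proof. by case: (proj1 (le_meet (x ⊓ y) x y) (le_refl _)). Qed.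

Lemma meet_ler (H : InfSl) (x y : H) : x ⊓ y ⊑ y.
Proof. by case: (proj1 (le_meet (x ⊓ y) x y) (le_refl _)). Qed.

Lemma rx_le (A B : P) (f : Hom A B) (x y : fib P B) :
  x ⊑ y -> rx f x ⊑ rx f y.
Proof.
move=> xy; have -> : x = x ⊓ y.
  by apply: le_antisym; [apply/le_meet; split=> //; apply: le_refl | apply: meet_lel].
by rewrite rx_meet; apply: meet_ler.
Qed.

Lemma pair_comp (X Y A B : P) (f : Hom X A) (g : Hom X B) (h : Hom Y X) :
  ⟨f, g⟩ ∘ h = ⟨f ∘ h, g ∘ h⟩.
Proof.
by rewrite -[LHS](pair_eta (lim P)) !comp_assoc pair_pr1 pair_pr2.
Qed.

End Facts.

(** * The category of points *)

Section Points.
Variable P : LexDoctrine.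

Record pt_ob : Type := MkPt { pt_base : P; pt_pred : fib P pt_base }.

Definition pt_hom (a b : pt_ob) : Type :=
  {f : Hom (pt_base a) (pt_base b) | pt_pred a ⊑ rx f (pt_pred b)}.

Lemma pt_hom_eq (a b : pt_ob) (f g : pt_hom a b) :
  proj1_sig f = proj1_sig g -> f = g.
Proof.
case: f g => [f hf] [g hg] /= e; move: hf; rewrite e => hf.
by rewrite (proof_irrelevance _ hf hg).
Qed.

Definition pt_id (a : pt_ob) : pt_hom a a.
Proof. by exists (idm _); rewrite rx_id; apply: le_refl. Defined.

Definition pt_comp (a b c : pt_ob) (g : pt_hom b c) (f : pt_hom a b) : pt_hom a c.
Proof.
exists (proj1_sig g ∘ proj1_sig f); rewrite rx_comp.
by apply: le_trans (proj2_sig f) _; apply/rx_le/(proj2_sig g).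
Defined.

Definition points : Category.
Proof.
apply: (@MkCategory pt_ob pt_hom pt_id pt_comp).
- by move=> a b f; apply: pt_hom_eq; apply: comp_idl.
- by move=> a b f; apply: pt_hom_eq; apply: comp_idr.
- by move=> a b c d h g f; apply: pt_hom_eq; apply: comp_assoc.
Defined.

End Points.

(** * Weak dependent products and generic proofs *)

(** Candidate data for a weak dependent product of [f : X -> J] along
    [g : J -> I]: [wd_E], with projections [wd_p] and [wd_q], is a pullback of
    [g] and [wd_h]. *)
Record WdpData (C : Category) (X J I : C) (f : Hom X J) (g : Hom J I) : Type :=
  MkWdpData {
    wd_Z : C;
    wd_h : Hom wd_Z I;
    wd_E : C;
    wd_p : Hom wd_E J;
    wd_q : Hom wd_E wd_Z;
    wd_pullback : is_pullback g wd_h wd_p wd_q;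
    wd_e : Hom wd_E X;
    wd_over : f ∘ wd_e = wd_p
  }.

Definition is_weak_dependent_product (C : Category) (X J I : C) (f : Hom X J)
    (g : Hom J I) (d : WdpData f g) : Prop :=
  forall d' : WdpData f g,
    exists (w : Hom (wd_Z d') (wd_Z d)) (k : Hom (wd_E d') (wd_E d)),
      wd_h d' = wd_h d ∘ w /\
      (wd_p d ∘ k = wd_p d' /\ wd_q d ∘ k = w ∘ wd_q d') /\
      wd_e d' = wd_e d ∘ k.

Definition has_weak_dependent_products (C : Category) : Prop :=
  forall (X J I : C) (f : Hom X J) (g : Hom J I),
    exists d : WdpData f g, is_weak_dependent_product d.

Definition is_generic_proof (C : Category) (Th La : C) (th : Hom Th La) : Prop :=
  forall (Y X : C) (f : Hom Y X),
    exists (u : Hom X La) (Q : C) (p : Hom Q X) (q : Hom Q Th),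
      is_pullback u th p q /\
      (exists s : Hom Y Q, f = p ∘ s) /\ (exists t : Hom Q Y, p = f ∘ t).

Definition has_generic_proof (C : Category) : Prop :=
  exists (Th La : C) (th : Hom Th La), is_generic_proof th.

Definition ex_supercompactifiable (P : LexDoctrine) : Prop :=
  has_weak_dependent_products (points P) /\ has_generic_proof (points P).

(** * Poset reflection of a preorder *)

Section Reflection.
Variables (X : Type) (r : X -> X -> Prop).
Hypothesis r_refl : forall x, r x x.
Hypothesis r_trans : forall x y z, r x y -> r y z -> r x z.

(** Equivalence classes of [r x y /\ r y x]. *)
Definition refl_car : Type :=
  {S : X -> Prop | exists x, S = fun y => r x y /\ r y x}.

Definition refl_cl (x : X) : refl_car :=
  exist _ (fun y => r x y /\ r y x) (ex_intro _ x eq_refl).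

Definition refl_le (S T : refl_car) : Prop :=
  exists x y, proj1_sig S x /\ proj1_sig T y /\ r x y.

Definition refl_repr (S : refl_car) : X :=
  proj1_sig (constructive_indefinite_description _ (proj2_sig S)).

Lemma refl_cl_eq (x y : X) : r x y -> r y x -> refl_cl x = refl_cl y.
Proof.
move=> xy yx; rewrite /refl_cl.
have e : (fun z => r x z /\ r z x) = (fun z => r y z /\ r z y).
  apply: functional_extensionality => z; apply: propositional_extensionality.
  by split=> -[h1 h2]; split; eauto.
apply: (eq_sig_hprop (fun S => proof_irrelevance _)); exact: e.
Qed.

Lemma refl_repr_cl (S : refl_car) : refl_cl (refl_repr S) = S.
Proof.
apply: (eq_sig_hprop (fun S => proof_irrelevance _)) => /=.
rewrite /refl_repr; by case: constructive_indefinite_description => x /= ->.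
Qed.

Lemma refl_clE (x y : X) : refl_le (refl_cl x) (refl_cl y) <-> r x y.
Proof.
split=> [[x' [y' [[h1 h2] [[h3 h4] h5]]]]|xy]; first by eauto.
by exists x, y; split=> //=; split=> //=.
Qed.

Lemma refl_ind (Q : refl_car -> Prop) : (forall x, Q (refl_cl x)) -> forall S, Q S.
Proof. by move=> h S; rewrite -(refl_repr_cl S). Qed.

Lemma refl_repr_le (x : X) : r (refl_repr (refl_cl x)) x /\ r x (refl_repr (refl_cl x)).
Proof. by split; apply/refl_clE; rewrite refl_repr_cl; apply/refl_clE. Qed.

Variables (t : X) (m : X -> X -> X).
Hypothesis r_top : forall x, r x t.
Hypothesis r_meet : forall z x y, r z (m x y) <-> r z x /\ r z y.

Definition reflection : InfSl.
Proof.
apply: (@MkInfSl refl_car refl_le _ _ _ (refl_cl t) _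
          (fun S T => refl_cl (m (refl_repr S) (refl_repr T)))).
- by elim/refl_ind=> x; apply/refl_clE.
- elim/refl_ind=> x; elim/refl_ind=> y; elim/refl_ind=> z.
  by move=> /refl_clE xy /refl_clE yz; apply/refl_clE; eauto.
- elim/refl_ind=> x; elim/refl_ind=> y /refl_clE xy /refl_clE yx.
  exact: refl_cl_eq.
- by elim/refl_ind=> x; apply/refl_clE.
- elim/refl_ind=> z S T; rewrite refl_clE r_meet -!refl_clE !refl_repr_cl.
  by [].
Defined.

End Reflection.

(** * The full existential completion *)

Section Completion.
Variable P : LexDoctrine.

(** Pairs [(f : B -> A, x)] with [x] in the fibre over [B]. *)
Record pre_fib (A : P) : Type := MkPreFib {
  pf_dom : P;
  pf_arr : Hom pf_dom A;
  pf_pred : fib P pf_dom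
}.

Definition pre_le (A : P) (u v : pre_fib A) : Prop :=
  exists h : Hom (pf_dom u) (pf_dom v),
    pf_arr u = pf_arr v ∘ h /\ pf_pred u ⊑ rx h (pf_pred v).

Definition pre_top (A : P) : pre_fib A := MkPreFib (idm A) top.

Definition pre_meet (A : P) (u v : pre_fib A) : pre_fib A :=
  let p := pb1 (lim P) (pf_arr u) (pf_arr v) in
  let q := pb2 (lim P) (pf_arr u) (pf_arr v) in
  MkPreFib (pf_arr u ∘ p) (rx p (pf_pred u) ⊓ rx q (pf_pred v)).

Definition pre_rx (A B : P) (f : Hom A B) (v : pre_fib B) : pre_fib A :=
  MkPreFib (pb1 (lim P) f (pf_arr v)) (rx (pb2 (lim P) f (pf_arr v)) (pf_pred v)).

Definition pre_ex (A B : P) (f : Hom A B) (u : pre_fib A) : pre_fib B :=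
  MkPreFib (f ∘ pf_arr u) (pf_pred u).

Lemma pre_le_refl (A : P) (u : pre_fib A) : pre_le u u.
Proof. by exists (idm _); rewrite comp_idr rx_id; split=> //; apply: le_refl. Qed.

Lemma pre_le_trans (A : P) (u v w : pre_fib A) :
  pre_le u v -> pre_le v w -> pre_le u w.
Proof.
move=> [h [e1 l1]] [k [e2 l2]]; exists (k ∘ h); rewrite comp_assoc -e2; split=> //.
by rewrite rx_comp; apply: le_trans l1 _; apply: rx_le.
Qed.

Lemma pre_le_top (A : P) (u : pre_fib A) : pre_le u (pre_top A).
Proof.
by exists (pf_arr u); rewrite /= comp_idl rx_top; split=> //; apply: le_top.
Qed.

Lemma pre_le_meet (A : P) (w u v : pre_fib A) :
  pre_le w (pre_meet u v) <-> pre_le w u /\ pre_le w v.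
Proof.
have [sq up] := pb_pullback (lim P) (pf_arr u) (pf_arr v); split.
  move=> [h []]; rewrite /= rx_meet -!rx_comp => e /le_meet [l1 l2].
  split; [exists (pb1 (lim P) (pf_arr u) (pf_arr v) ∘ h)
         |exists (pb2 (lim P) (pf_arr u) (pf_arr v) ∘ h)].
    by rewrite comp_assoc.
  by rewrite comp_assoc -sq.
move=> [[h [e1 l1]] [k [e2 l2]]].
have [l [[a b] _]] := up _ h k (eq_trans (eq_sym e1) e2).
exists l; rewrite /= -comp_assoc a; split=> //.
by rewrite rx_meet -!rx_comp a b; apply/le_meet.
Qed.

Lemma pre_rx_adj (A B : P) (f : Hom A B) (u : pre_fib A) (v : pre_fib B) :
  pre_le u (pre_rx f v) <-> pre_le (pre_ex f u) v.
Proof.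
have [sq up] := pb_pullback (lim P) f (pf_arr v); split.
  move=> [h [/= e l]]; exists (pb2 (lim P) f (pf_arr v) ∘ h).
  by rewrite /= comp_assoc -sq -comp_assoc -e rx_comp.
move=> [h [/= e l]]; have [k [[a b] _]] := up _ _ _ e.
by exists k; rewrite /= -rx_comp a b.
Qed.

Definition exc_fib (A : P) : InfSl :=
  reflection (@pre_le_refl A) (@pre_le_trans A) (@pre_le_top A) (@pre_le_meet A).

Definition exc_cl (A : P) (u : pre_fib A) : exc_fib A := refl_cl (@pre_le A) u.

Definition exc_rx (A B : P) (f : Hom A B) (v : exc_fib B) : exc_fib A :=
  exc_cl (pre_rx f (refl_repr v)).

Lemma exc_clE (A : P) (u v : pre_fib A) : exc_cl u ⊑ exc_cl v <-> pre_le u v.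
Proof. exact: (refl_clE (@pre_le_refl A) (@pre_le_trans A)). Qed.

Lemma exc_repr_cl (A : P) (x : exc_fib A) : exc_cl (refl_repr x) = x.
Proof. exact: refl_repr_cl. Qed.

Lemma exc_le_rx (A B : P) (f : Hom A B) (u : pre_fib A) (v : exc_fib B) :
  exc_cl u ⊑ exc_rx f v <-> exc_cl (pre_ex f u) ⊑ v.
Proof. by rewrite -{2}(exc_repr_cl v) !exc_clE pre_rx_adj. Qed.

Lemma exc_ext (A : P) (x y : exc_fib A) :
  (forall u : pre_fib A, exc_cl u ⊑ x <-> exc_cl u ⊑ y) -> x = y.
Proof.
move=> h; apply: le_antisym.
  by rewrite -(exc_repr_cl x); apply/h; rewrite exc_repr_cl; apply: le_refl.
by rewrite -(exc_repr_cl y); apply/h; rewrite exc_repr_cl; apply: le_refl.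
Qed.

Definition ex_completion : LexDoctrine.
Proof.
apply: (@MkLexDoctrine P (lim P) exc_fib exc_rx).
- move=> A B f; apply: exc_ext => u; rewrite exc_le_rx.
  by split=> _; apply: le_top.
- move=> A B f x y; apply: exc_ext => u.
  by rewrite exc_le_rx !le_meet !exc_le_rx.
- move=> A x; apply: exc_ext => u; rewrite exc_le_rx.
  by rewrite /pre_ex comp_idl; case: u.
- move=> A B C g f x; apply: exc_ext => u; rewrite !exc_le_rx.
  by rewrite /pre_ex /= comp_assoc.
Defined.

End Completion.

(** * The tripos-to-topos construction *)

Section TriposToTopos.
Variables (R : LexDoctrine) (X : FullExistential R).

(** Over [A × B × C], that is [(A × B) × C], the three projections. *)
Local Notation p1 := (π1 ∘ π1).
Local Notation p2 := (π2 ∘ π1).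
Local Notation p3 := π2.

Definition is_per (A : R) (rho : fib R (A ×[R] A)) : Prop :=
  rho ⊑ rx ⟨π2, π1⟩ rho /\
  rx ⟨p1, p2⟩ rho ⊓ rx ⟨p2, p3⟩ rho ⊑
    (rx ⟨p1, p3⟩ rho : fib R (A ×[R] A ×[R] A)).

Record tt_ob : Type := MkTT {
  tt_car : R;
  tt_eq : fib R (tt_car ×[R] tt_car);
  tt_per : is_per tt_eq
}.

Record is_funrel (a b : tt_ob) (phi : fib R (tt_car a ×[R] tt_car b)) : Prop :=
  MkFunrel {
    fr_strict : phi ⊑ rx ⟨π1, π1⟩ (tt_eq a) ⊓ rx ⟨π2, π2⟩ (tt_eq b);
    fr_left : rx ⟨p1, p2⟩ (tt_eq a) ⊓ rx ⟨p1, p3⟩ phi ⊑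
      (rx ⟨p2, p3⟩ phi : fib R (tt_car a ×[R] tt_car a ×[R] tt_car b));
    fr_right : rx ⟨p2, p3⟩ (tt_eq b) ⊓ rx ⟨p1, p2⟩ phi ⊑
      (rx ⟨p1, p3⟩ phi : fib R (tt_car a ×[R] tt_car b ×[R] tt_car b));
    fr_single : rx ⟨p1, p2⟩ phi ⊓ rx ⟨p1, p3⟩ phi ⊑
      (rx ⟨p2, p3⟩ (tt_eq b) : fib R (tt_car a ×[R] tt_car b ×[R] tt_car b));
    fr_total : rx ⟨idm _, idm _⟩ (tt_eq a) ⊑ ex X π1 phi
  }.

Definition tt_hom (a b : tt_ob) : Type :=
  {phi : fib R (tt_car a ×[R] tt_car b) | is_funrel phi}.

Definition rel_comp (A B C : R) (psi : fib R (B ×[R] C)) (phi : fib R (A ×[R] B)) :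
    fib R (A ×[R] C) :=
  ex X (⟨p1, p3⟩ : Hom (A ×[R] B ×[R] C) _)
    (rx ⟨p1, p2⟩ phi ⊓ rx ⟨p2, p3⟩ psi).

(** Reasoning with generalised elements: [c ⊢ phi [a, b]] says that [phi] holds
    of [a] and [b] under the hypothesis [c]. *)
Local Notation "c ⊢ phi [ a , b ]" := (c ⊑ rx ⟨a, b⟩ phi)
  (at level 70, phi at level 9, a at level 60, b at level 60).

Lemma pairE1 (Z A B : R) (f : Hom Z A) (g : Hom Z B) : π1 ∘ ⟨f, g⟩ = f.
Proof. exact: pair_pr1. Qed.

Lemma pairE2 (Z A B : R) (f : Hom Z A) (g : Hom Z B) : π2 ∘ ⟨f, g⟩ = g.
Proof. exact: pair_pr2. Qed.

Lemma tripleE1 (Z A B C : R) (f : Hom Z A) (g : Hom Z B) (h : Hom Z C) :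
  p1 ∘ ⟨⟨f, g⟩, h⟩ = f.
Proof. by rewrite -comp_assoc !pairE1. Qed.

Lemma tripleE2 (Z A B C : R) (f : Hom Z A) (g : Hom Z B) (h : Hom Z C) :
  p2 ∘ ⟨⟨f, g⟩, h⟩ = g.
Proof. by rewrite -comp_assoc pairE1 pairE2. Qed.

Definition gen := (pair_comp, tripleE1, tripleE2, pairE1, pairE2).

Lemma rel_le (A B : R) (x y : fib R (A ×[R] B)) :
  (forall (Z : R) (c : fib R Z) a b, c ⊢ x [a, b] -> c ⊢ y [a, b]) -> x ⊑ y.
Proof.
move=> h; have e : ⟨π1, π2⟩ = idm (A ×[R] B).
  by rewrite -[RHS](pair_eta (lim R)) !comp_idr.
have := h _ x π1 π2; rewrite e !rx_id; apply; exact: le_refl.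
Qed.

Lemma entails_rx (Z Y A B : R) (c : fib R Z) (d : fib R Y) (s : Hom Y Z) x
    (a : Hom Z A) (b : Hom Z B) :
  d ⊑ rx s c -> c ⊢ x [a, b] -> d ⊢ x [a ∘ s, b ∘ s].
Proof.
by move=> l h; rewrite -pair_comp rx_comp; apply: le_trans l _; apply: rx_le.
Qed.

Lemma ex_elim (Z D E : R) (t : Hom D E) (x : fib R D) (e : Hom Z E)
    (c d : fib R Z) :
  c ⊑ rx e (ex X t x) ->
  (forall (Y : R) (s : Hom Y Z) (u : Hom Y D) (c' : fib R Y),
     t ∘ u = e ∘ s -> c' ⊑ rx s c -> c' ⊑ rx u x -> c' ⊑ rx s d) ->
  c ⊑ d.
Proof.
have pbk := pb_pullback (lim R) t e.
rewrite (ex_beck_chevalley X pbk) => l h.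
set q := pb2 (lim R) t e in pbk l *.
apply: (@le_trans _ _ (ex X q (rx (pb1 (lim R) t e) x) ⊓ c)).
  by apply/le_meet; split=> //; apply: le_refl.
rewrite -ex_frobenius; apply/ex_adj.
by apply: h (proj1 pbk) _ _; [apply: meet_ler | apply: meet_lel].
Qed.

Lemma ex_intro_rx (Z D E : R) (t : Hom D E) (x : fib R D) (u : Hom Z D)
    (c : fib R Z) : c ⊑ rx u x -> c ⊑ rx (t ∘ u) (ex X t x).
Proof.
move=> h; rewrite rx_comp; apply: le_trans h _; apply: rx_le.
by apply/ex_adj; apply: le_refl.
Qed.

Lemma rel_comp_intro (A B C Z : R) (psi : fib R (B ×[R] C)) (phi : fib R (A ×[R] B))
    (c : fib R Z) a b d :
  c ⊢ phi [a, b] -> c ⊢ psi [b, d] -> c ⊢ (rel_comp psi phi) [a, d].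
Proof.
move=> h1 h2; rewrite /rel_comp.
have -> : ⟨a, d⟩ = ⟨p1, p3⟩ ∘ ⟨⟨a, b⟩, d⟩ by rewrite !gen.
by apply: ex_intro_rx; rewrite rx_meet -!rx_comp !gen; apply/le_meet.
Qed.

Lemma rel_comp_elim (A B C Z : R) (psi : fib R (B ×[R] C)) (phi : fib R (A ×[R] B))
    (c g : fib R Z) a d :
  c ⊢ (rel_comp psi phi) [a, d] ->
  (forall (Y : R) (s : Hom Y Z) (b : Hom Y B) (c' : fib R Y), c' ⊑ rx s c ->
     c' ⊢ phi [a ∘ s, b] -> c' ⊢ psi [b, d ∘ s] -> c' ⊑ rx s g) ->
  c ⊑ g.
Proof.
move=> h k; apply: (ex_elim h) => Y s u c' e l.
rewrite rx_meet -!rx_comp !pair_comp.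
have e1 : p1 ∘ u = a ∘ s.
  have := f_equal (comp π1) e; by rewrite !gen.
have e3 : p3 ∘ u = d ∘ s.
  have := f_equal (comp π2) e; by rewrite !gen.
rewrite e1 e3 => /le_meet [l1 l2]; exact: k l l1 l2.
Qed.

Section Per.
Variable a : tt_ob.

Lemma per_sym (Z : R) (c : fib R Z) u v :
  c ⊢ (tt_eq a) [u, v] -> c ⊢ (tt_eq a) [v, u].
Proof.
move=> h; apply: le_trans h _.
by have := rx_le ⟨u, v⟩ (proj1 (tt_per a)); rewrite -rx_comp !gen.
Qed.

Lemma per_trans (Z : R) (c : fib R Z) u v w :
  c ⊢ (tt_eq a) [u, v] -> c ⊢ (tt_eq a) [v, w] -> c ⊢ (tt_eq a) [u, w].
Proof.
move=> h1 h2; have := rx_le ⟨⟨u, v⟩, w⟩ (proj2 (tt_per a)).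
by rewrite rx_meet -!rx_comp !gen; apply: le_trans; apply/le_meet.
Qed.

End Per.

Section Funrel.
Variables (a b : tt_ob) (phi : fib R (tt_car a ×[R] tt_car b)).
Hypothesis F : is_funrel phi.

Lemma funrel_strict (Z : R) (c : fib R Z) u v :
  c ⊢ phi [u, v] -> c ⊢ (tt_eq a) [u, u] /\ c ⊢ (tt_eq b) [v, v].
Proof.
move=> h; have := rx_le ⟨u, v⟩ (fr_strict F).
by rewrite rx_meet -!rx_comp !gen => /(le_trans h) /le_meet.
Qed.

Lemma funrel_left (Z : R) (c : fib R Z) u u' v :
  c ⊢ (tt_eq a) [u, u'] -> c ⊢ phi [u, v] -> c ⊢ phi [u', v].
Proof.
move=> h1 h2; have := rx_le ⟨⟨u, u'⟩, v⟩ (fr_left F).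
by rewrite rx_meet -!rx_comp !gen; apply: le_trans; apply/le_meet.
Qed.

Lemma funrel_right (Z : R) (c : fib R Z) u v v' :
  c ⊢ (tt_eq b) [v, v'] -> c ⊢ phi [u, v] -> c ⊢ phi [u, v'].
Proof.
move=> h1 h2; have := rx_le ⟨⟨u, v⟩, v'⟩ (fr_right F).
by rewrite rx_meet -!rx_comp !gen; apply: le_trans; apply/le_meet.
Qed.

Lemma funrel_single (Z : R) (c : fib R Z) u v v' :
  c ⊢ phi [u, v] -> c ⊢ phi [u, v'] -> c ⊢ (tt_eq b) [v, v'].
Proof.
move=> h1 h2; have := rx_le ⟨⟨u, v⟩, v'⟩ (fr_single F).
by rewrite rx_meet -!rx_comp !gen; apply: le_trans; apply/le_meet.
Qed.

Lemma funrel_total (Z : R) (c g : fib R Z) u :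
  c ⊢ (tt_eq a) [u, u] ->
  (forall (Y : R) (s : Hom Y Z) (v : Hom Y (tt_car b)) (c' : fib R Y),
     c' ⊑ rx s c -> c' ⊢ phi [u ∘ s, v] -> c' ⊑ rx s g) ->
  c ⊑ g.
Proof.
move=> h k; have h' : c ⊑ rx u (ex X π1 phi).
  apply: le_trans h _; have := rx_le u (fr_total F).
  by rewrite -rx_comp pair_comp !comp_idl.
apply: (ex_elim h') => Y s d c' e l1 l2.
by apply: (k Y s (π2 ∘ d)) => //; rewrite -e pair_eta.
Qed.

End Funrel.

(** The generalised-element form of the conditions is also sufficient. *)
Lemma funrel_intro (a b : tt_ob) (phi : fib R (tt_car a ×[R] tt_car b)) :
  (forall Z (c : fib R Z) u v, c ⊢ phi [u, v] ->
     c ⊢ (tt_eq a) [u, u] /\ c ⊢ (tt_eq b) [v, v]) ->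
  (forall Z (c : fib R Z) u u' v,
     c ⊢ (tt_eq a) [u, u'] -> c ⊢ phi [u, v] -> c ⊢ phi [u', v]) ->
  (forall Z (c : fib R Z) u v v',
     c ⊢ (tt_eq b) [v, v'] -> c ⊢ phi [u, v] -> c ⊢ phi [u, v']) ->
  (forall Z (c : fib R Z) u v v',
     c ⊢ phi [u, v] -> c ⊢ phi [u, v'] -> c ⊢ (tt_eq b) [v, v']) ->
  (forall Z (c : fib R Z) u, c ⊢ (tt_eq a) [u, u] -> c ⊑ rx u (ex X π1 phi)) ->
  is_funrel phi.
Proof.
move=> h1 h2 h3 h4 h5; split.
- apply: rel_le => Z c u v /h1 [l1 l2].
  by rewrite rx_meet -!rx_comp !gen; apply/le_meet.
- by apply: h2; [apply: meet_lel | apply: meet_ler].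
- by apply: h3; [apply: meet_lel | apply: meet_ler].
- by apply: h4; [apply: meet_lel | apply: meet_ler].
- by rewrite -[ex X π1 phi]rx_id; apply: h5; apply: le_refl.
Qed.

Lemma tt_hom_eq (a b : tt_ob) (f g : tt_hom a b) :
  proj1_sig f = proj1_sig g -> f = g.
Proof.
case: f g => [f hf] [g hg] /= e; move: hf; rewrite e => hf.
by rewrite (proof_irrelevance _ hf hg).
Qed.

Lemma funrel_id (a : tt_ob) : @is_funrel a a (tt_eq a).
Proof.
apply: funrel_intro.
- move=> Z c u v h; split; first exact: per_trans h (per_sym h).
  exact: per_trans (per_sym h) h.
- by move=> Z c u u' v h1; apply: per_trans (per_sym h1).
- by move=> Z c u v v' h1 h2; apply: per_trans h2 h1.
- by move=> Z c u v v' h1; apply: per_trans (per_sym h1).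
- move=> Z c u h; have -> : u = π1 ∘ ⟨u, u⟩ by rewrite pairE1.
  exact: ex_intro_rx.
Qed.

Lemma funrel_comp (a b d : tt_ob) psi phi :
  @is_funrel b d psi -> @is_funrel a b phi -> @is_funrel a d (rel_comp psi phi).
Proof.
move=> G F; apply: funrel_intro.
- move=> Z c u v h; split; apply: (rel_comp_elim h) => Y s w c' l h1 h2.
    by rewrite -rx_comp pair_comp; case: (funrel_strict F h1).
  by rewrite -rx_comp pair_comp; case: (funrel_strict G h2).
- move=> Z c u u' v e h; apply: (rel_comp_elim h) => Y s w c' l h1 h2.
  rewrite -rx_comp pair_comp; apply: rel_comp_intro h2.
  exact: (funrel_left F) (entails_rx l e) h1.
- move=> Z c u v v' e h; apply: (rel_comp_elim h) => Y s w c' l h1 h2.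
  rewrite -rx_comp pair_comp; apply: rel_comp_intro h1 _.
  exact: (funrel_right G) (entails_rx l e) h2.
- move=> Z c u v v' h h'; apply: (rel_comp_elim h) => Y s w c' l h1 h2.
  apply: (rel_comp_elim (entails_rx l h')) => Y' s' w' c'' l' h1' h2'.
  rewrite -!rx_comp pair_comp !comp_assoc.
  apply: (funrel_single G) (entails_rx l' h2) _.
  apply: (funrel_left G) h2'.
  exact: (funrel_single F) h1' (entails_rx l' h1).
- move=> Z c u h; apply: (funrel_total F h) => Y s v c' l h1.
  have [_ hv] := funrel_strict F h1.
  apply: (funrel_total G hv) => Y' s' w c'' l' h2.
  have h3 := rel_comp_intro (entails_rx l' h1) h2.
  rewrite -!rx_comp.
  by have := ex_intro_rx π1 h3; rewrite pairE1 !comp_assoc.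
Qed.

Definition tt_id (a : tt_ob) : tt_hom a a := exist _ _ (funrel_id a).

Definition tt_comp (a b d : tt_ob) (g : tt_hom b d) (f : tt_hom a b) : tt_hom a d :=
  exist _ (rel_comp (proj1_sig g) (proj1_sig f))
    (funrel_comp (proj2_sig g) (proj2_sig f)).

Definition tripos_to_topos : Category.
Proof.
apply: (@MkCategory tt_ob tt_hom tt_id tt_comp).
- move=> a b [f F]; apply: tt_hom_eq => /=; apply: le_antisym.
    apply: rel_le => Z c u v h; apply: (rel_comp_elim h) => Y s w c' l h1 h2.
    by rewrite -rx_comp pair_comp; apply: (funrel_right F) h2 h1.
  apply: rel_le => Z c u v h; apply: (rel_comp_intro h).
  by case: (funrel_strict F h).
- move=> a b [f F]; apply: tt_hom_eq => /=; apply: le_antisym.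
    apply: rel_le => Z c u v h; apply: (rel_comp_elim h) => Y s w c' l h1 h2.
    by rewrite -rx_comp pair_comp; apply: (funrel_left F) (per_sym h1) h2.
  apply: rel_le => Z c u v h; apply: (rel_comp_intro _ h).
  by case: (funrel_strict F h).
- move=> a b d e [h H] [g G] [f F]; apply: tt_hom_eq => /=; apply: le_antisym.
    apply: rel_le => Z c u v k; apply: (rel_comp_elim k) => Y s w c' l h1 h2.
    apply: (rel_comp_elim h1) => Y' s' w' c'' l' h3 h4.
    rewrite -!rx_comp pair_comp !comp_assoc; apply: rel_comp_intro h3 _.
    by apply: rel_comp_intro h4 _; apply: entails_rx l' h2.
  apply: rel_le => Z c u v k; apply: (rel_comp_elim k) => Y s w c' l h1 h2.
  apply: (rel_comp_elim h2) => Y' s' w' c'' l' h3 h4.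
  rewrite -!rx_comp pair_comp !comp_assoc.
  apply: rel_comp_intro h4; apply: rel_comp_intro h3.
  exact: entails_rx l' h1.
Defined.

End TriposToTopos.

(* Main.v *)
From Stdlib Require Import ssreflect ssrbool IndefiniteDescription.
Require Import Defs.

(** Write [Q] for the completion [ex_completion P].

    [Q] is a tripos: an element of [Q A] is an arrow into [(A, top)] in the
    category of points, up to mutual factorization.  Weak dependent products in
    the category of points therefore give universal quantification and
    implication in [Q], and a weak exponential of the codomain of a generic proof
    gives weak power objects; bottom and joins are then definable by second-order
    quantification.

    The principal elements [x |-> (id, x)] embed [P] in [Q], and [(f, x) |-> ∃_f x]
    is a left adjoint, which preserves finite meets by Frobenius and Beck-Chevalley.
    It commutes with reindexing and with [∃], so it induces a functor [L] between
    the toposes, lex because terminal objects and pullbacks are characterized by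
    sequents of regular logic.  For its right adjoint, given [(A, rho)] let
    [chi (s, x)] say that [s] is the rho-class of [x]: every single-valued relation
    [phi (b, x)] is [chi (h b, x)] for an arrow [h] of the base.  So [chi] is an
    isomorphism from [(S, chi° ; chi)] to [(A, rho)], and it is the
    universal arrow from [L] when the relation on [S] is read in [Q] as a principal
    element. *)

Set Implicit Arguments.
Unset Strict Implicit.
Unset Printing Implicit Defensive.

(** * Order-theoretic tools for inf-semilattices *)

Lemma le_meet_mono (H : InfSl) (x x' y y' : H) :
  x ⊑ x' -> y ⊑ y' -> x ⊓ y ⊑ x' ⊓ y'.
Proof.
move=> l1 l2; apply/le_meet; split.
  exact: le_trans (meet_lel _ _) l1.
exact: le_trans (meet_ler _ _) l2.
Qed.

Lemma lower_ext (H : InfSl) (x y : H) : (forall z, z ⊑ x <-> z ⊑ y) -> x = y.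
Proof. by move=> h; apply: le_antisym; apply/h; apply: le_refl. Qed.

Lemma upper_ext (H : InfSl) (x y : H) : (forall z, x ⊑ z <-> y ⊑ z) -> x = y.
Proof. by move=> h; apply: le_antisym; apply/h; apply: le_refl. Qed.

Lemma meetC (H : InfSl) (x y : H) : x ⊓ y = y ⊓ x.
Proof. by apply: lower_ext => z; rewrite !le_meet; tauto. Qed.

(** * Triposes from implication, universal quantification and weak power objects *)

Section ImplicationalTripos.
Variables (P : LexDoctrine) (X : FullExistential P).
Hypothesis has_imp : forall (A : P) (x y : fib P A),
  exists w, forall z, z ⊑ w <-> z ⊓ x ⊑ y.
Hypothesis has_all : forall (A B : P) (f : Hom A B) (x : fib P A),
  exists w, forall z, z ⊑ w <-> rx f z ⊑ x.
Hypothesis weak_power : has_weak_power_objects P.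

Let wimp (A : P) (x y : fib P A) :=
  proj1_sig (constructive_indefinite_description _ (has_imp x y)).
Let wall (A B : P) (f : Hom A B) (x : fib P A) :=
  proj1_sig (constructive_indefinite_description _ (has_all f x)).

Let le_wimp (A : P) (x y z : fib P A) : z ⊑ wimp x y <-> z ⊓ x ⊑ y.
Proof. by rewrite /wimp; case: constructive_indefinite_description. Qed.

Let le_wall (A B : P) (f : Hom A B) (x : fib P A) (z : fib P B) :
  z ⊑ wall f x <-> rx f z ⊑ x.
Proof. by rewrite /wall; case: constructive_indefinite_description. Qed.

(** Elements of [fib P A] are classified by arrows from [A] to the weak power
    object of [1], so [∀] along a projection computes infima of definable
    families; joins are the infima of upper bounds. *)
Lemma definable_inf : exists (O : P) (t : fib P O), forall (A : P) (z : fib P A),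
  exists c : Hom A O, z = rx c t.
Proof.
have [O [i h]] := weak_power (one (lim P)).
have [bang _] : exists bang : Hom O (one (lim P)), True.
  by have [b _] := one_terminal (lim P) O; exists b.
exists O, (rx ⟨bang, idm O⟩ i) => A z.
have [c e] := h A (rx π2 z); exists c.
have [b [_ bu]] := one_terminal (lim P) A.
have := f_equal (rx ⟨b, idm A⟩) e.
rewrite -!rx_comp pair_pr2 rx_id => ->.
rewrite !pair_comp -comp_assoc pair_pr1 pair_pr2 comp_idl comp_idr.
by rewrite -(bu (bang ∘ c)).
Qed.

(** Falsity is [∀ t. t] over the truth values [O]. Instantiating [t] at the arrow that classifies
    [x] shows that it lies below [x]. *)
Lemma has_bot (A : P) : exists b : fib P A, forall x, b ⊑ x.
Proof.
have [O [t h]] := definable_inf.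
exists (wall (π1 : Hom (A ×[P] O) A) (rx π2 t)) => x.
have [c ->] := h _ x.
have := rx_le ⟨idm A, c⟩ (proj1 (le_wall π1 (rx π2 t) _) (le_refl _)).
by rewrite -!rx_comp pair_pr1 pair_pr2 rx_id.
Qed.

(** Both sides are right adjoints, so it suffices to compare their left adjoints, where the claim
    becomes Frobenius reciprocity. *)
Let rx_wimp (A B : P) (f : Hom A B) (x y : fib P B) :
  rx f (wimp x y) = wimp (rx f x) (rx f y).
Proof.
apply: lower_ext => z; rewrite -(ex_adj X) !le_wimp -(ex_adj X).
by rewrite (ex_frobenius X).
Qed.

(** The second-order disjunction [∀ t. (x → t) ∧ (y → t) → t]. That it is an upper bound is pure
    implicational logic; that it is least follows by instantiating [t] at the name of [z]. *)
Lemma has_join (A : P) (x y : fib P A) :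
  exists j, forall z, j ⊑ z <-> x ⊑ z /\ y ⊑ z.
Proof.
have [O [t h]] := definable_inf.
pose a : Hom (A ×[P] O) A := π1; pose u : fib P (A ×[P] O) := rx π2 t.
exists (wall a (wimp (wimp (rx a x) u ⊓ wimp (rx a y) u) u)) => z; split.
  move=> l; have up (v : fib P A) : rx a v ⊓ (wimp (rx a x) u ⊓ wimp (rx a y) u) ⊑ u ->
      v ⊑ z.
    by move=> k; apply: le_trans l; apply/le_wall/le_wimp.
  have app (v : fib P A) (w : fib P (A ×[P] O)) : w ⊑ wimp (rx a v) u -> rx a v ⊓ w ⊑ u.
    by move=> k; rewrite meetC; apply/le_wimp.
  by split; apply: up; apply: app; [apply: meet_lel | apply: meet_ler].
have [c ->] := h _ z; move=> [lx ly].
have := rx_le ⟨idm A, c⟩ (proj1 (le_wall a _ _) (le_refl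
  (wall a (wimp (wimp (rx a x) u ⊓ wimp (rx a y) u) u)))).
rewrite -rx_comp pair_pr1 rx_id => k; apply: le_trans k _.
rewrite !rx_wimp rx_meet !rx_wimp -!rx_comp pair_pr1 pair_pr2 !rx_id.
set w := wimp _ _; apply: (@le_trans _ _ (w ⊓ w)); first by apply/le_meet; split; apply: le_refl.
apply: (@le_trans _ _ (w ⊓ (wimp x (rx c t) ⊓ wimp y (rx c t)))).
  apply: le_meet_mono; first exact: le_refl.
  apply/le_meet; split; apply/le_wimp; apply: le_trans (meet_ler _ _) _ => //.
exact: (proj1 (le_wimp _ _ _) (le_refl _)).
Qed.

(** Reindexing preserves bottom and joins because it is left adjoint to [wall], and it preserves
    implication by [rx_wimp]. Beck-Chevalley for [∀] is the mate of Beck-Chevalley for [∃]. *)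
Lemma full_tripos_intro : exists T : FullTripos P, True.
Proof.
pose wbot A := proj1_sig (constructive_indefinite_description _ (has_bot A)).
have bot_wle A x : wbot A ⊑ x by rewrite /wbot; case: constructive_indefinite_description.
pose wjoin A x y := proj1_sig (constructive_indefinite_description _ (@has_join A x y)).
have wjoin_le A x y z : wjoin A x y ⊑ z <-> x ⊑ z /\ y ⊑ z.
  by rewrite /wjoin; case: constructive_indefinite_description.
pose H A := MkHeytingStructure (@bot_wle A) (@wjoin_le A) (@le_wimp A).
unshelve eexists (MkFullTripos (@MkFullFirstOrder P X H _ _ _ wall _ _) weak_power) => //=.
- move=> A B f; apply: le_antisym; last exact: bot_wle.
  by apply/(le_wall f); apply: bot_wle.
- move=> A B f x y; apply: upper_ext => z.
  by rewrite wjoin_le -!(le_wall f) wjoin_le.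
- move=> A B Y f g D p q pbk x; apply: lower_ext => z.
  rewrite le_wall -(ex_adj X g) le_wall -(ex_adj X p).
  (* Passing to left adjoints exchanges the two legs, so the condition on [∃] is needed for the
     transposed square. *)
  suff -> : rx f (ex X g z) = ex X p (rx q z) by [].
  apply: (ex_beck_chevalley X); case: pbk => e u; split=> // Z a b ab.
  have [h [[h1 h2] hu]] := u Z b a (eq_sym ab).
  by exists h; split=> // k [k1 k2]; apply: hu.
Qed.

End ImplicationalTripos.

(** * The full existential completion of a supercompactifiable doctrine *)

Section CompletionTripos.
Variable P : LexDoctrine.
Notation Q := (ex_completion P).
Notation rxQ f x := (@rx Q _ _ f x).

Lemma exc_ind (A : P) (K : fib Q A -> Prop) :
  (forall u : pre_fib A, K (exc_cl u)) -> forall x, K x.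
Proof. by move=> h x; rewrite -(exc_repr_cl x). Qed.

(** Classes of pairs [(w, m)] serve as generalized elements of [A] under a hypothesis, and
    inclusions in [Q] are tested on them. *)
Lemma exc_lower (A : P) (x y : fib Q A) :
  (forall (W : P) (w : Hom W A) m, exc_cl (MkPreFib w m) ⊑ x -> exc_cl (MkPreFib w m) ⊑ y) ->
  x ⊑ y.
Proof. by move: x; apply: exc_ind => -[W w m]; apply; apply: le_refl. Qed.

Lemma exc_le_rxQ (A B W : P) (f : Hom A B) (w : Hom W A) m (v : fib Q B) :
  exc_cl (MkPreFib w m) ⊑ rxQ f v <-> exc_cl (MkPreFib (f ∘ w) m) ⊑ v.
Proof. exact: exc_le_rx. Qed.

Definition exc_ex (A B : P) (f : Hom A B) (x : fib Q A) : fib Q B :=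
  exc_cl (pre_ex f (refl_repr x)).

Lemma exc_ex_adj (A B : P) (f : Hom A B) (x : fib Q A) (y : fib Q B) :
  exc_ex f x ⊑ y <-> x ⊑ rxQ f y.
Proof. by rewrite /exc_ex -exc_le_rx exc_repr_cl. Qed.

Lemma exc_ex_cl (A B : P) (f : Hom A B) (u : pre_fib A) :
  exc_ex f (exc_cl u) = exc_cl (pre_ex f u).
Proof. by apply: upper_ext => z; rewrite exc_ex_adj -exc_le_rx. Qed.

(** Existentials in the completion have witnesses: [∃_f] is composition with [f], so an inequality
    of pairs already contains an arrow that factors [w] through [f]. *)
Lemma exc_le_ex (A B W : P) (f : Hom A B) (x : fib Q A) (w : Hom W B) m :
  exc_cl (MkPreFib w m) ⊑ exc_ex f x ->
  exists a : Hom W A, w = f ∘ a /\ exc_cl (MkPreFib a m) ⊑ x.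
Proof.
move: x; apply: exc_ind => u; rewrite exc_ex_cl => /exc_clE [k [/= e l]].
exists (pf_arr u ∘ k); split; first by rewrite comp_assoc.
by apply/exc_clE; exists k.
Qed.

Lemma exc_ex_intro (A B W : P) (f : Hom A B) (x : fib Q A) (a : Hom W A) m :
  exc_cl (MkPreFib a m) ⊑ x -> exc_cl (MkPreFib (f ∘ a) m) ⊑ exc_ex f x.
Proof.
move=> l; apply/exc_le_rxQ; apply: le_trans l _.
by apply/exc_ex_adj; apply: le_refl.
Qed.

Definition completion_existential : FullExistential Q.
Proof.
apply: (@MkFullExistential Q exc_ex exc_ex_adj).
- move=> A B X f g D p q [sq up] x; apply: le_antisym.
    apply: exc_lower => W w m /exc_le_rxQ /exc_le_ex [a [e l]].
    have [d [[da <-] _]] := up _ _ _ (eq_sym e).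
    by apply: exc_ex_intro; apply/exc_le_rxQ; rewrite da.
  apply/exc_ex_adj; rewrite -rx_comp -[_ ∘ q]sq rx_comp.
  by apply: (@rx_le Q); apply/exc_ex_adj; apply: le_refl.
- move=> A B f x y; apply: le_antisym.
    apply/exc_ex_adj; rewrite rx_meet; apply: le_meet_mono; last exact: le_refl.
    by apply/exc_ex_adj; apply: le_refl.
  apply: exc_lower => W w m /le_meet [/exc_le_ex [a [-> l]] /exc_le_rxQ l2].
  by apply: exc_ex_intro; apply/le_meet.
Defined.

Definition exc_pr (A : P) (x : fib P A) : fib Q A := exc_cl (MkPreFib (idm A) x).

Lemma exc_le_pr (A W : P) (w : Hom W A) m (x : fib P A) :
  exc_cl (MkPreFib w m) ⊑ exc_pr x <-> m ⊑ rx w x.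
Proof.
rewrite /exc_pr exc_clE; split=> [[h /= []]|l]; first by rewrite comp_idl => <-.
by exists w; rewrite /= comp_idl.
Qed.

(** Every element of [Q] is an existential of a principal one. Together with Frobenius and
    Beck-Chevalley this reduces computations in [Q] to principal elements. *)
Lemma exc_clE_ex (A : P) (u : pre_fib A) :
  exc_cl u = exc_ex (pf_arr u) (exc_pr (pf_pred u)).
Proof. by rewrite exc_ex_cl /pre_ex /= comp_idr; case: u. Qed.

Definition pt_arr (a b : points P) (f : Hom (pt_base a) (pt_base b))
  (l : pt_pred a ⊑ rx f (pt_pred b)) : Hom a b := exist _ f l.

Lemma pt_arr_eq (a b : points P) (f g : Hom a b) : f = g -> proj1_sig f = proj1_sig g.
Proof. by move=> ->. Qed.

Lemma pt_pullback (J Z I : points P) (g : Hom J I) (h : Hom Z I) :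
  exists (E : points P) (p : Hom E J) (q : Hom E Z), is_pullback g h p q.
Proof.
pose p := pb1 (lim P) (proj1_sig g) (proj1_sig h).
pose q := pb2 (lim P) (proj1_sig g) (proj1_sig h).
have [sq up] := pb_pullback (lim P) (proj1_sig g) (proj1_sig h).
pose E : points P := MkPt (rx p (pt_pred J) ⊓ rx q (pt_pred Z)).
exists E, (pt_arr (a:=E) (b:=J) (f:=p) (meet_lel _ _)).
exists (pt_arr (a:=E) (b:=Z) (f:=q) (meet_ler _ _)).
split=> [|T a b e]; first exact/pt_hom_eq/sq.
have [k [[ka kb] ku]] := up _ _ _ (pt_arr_eq e).
have lk : pt_pred T ⊑ rx k (pt_pred E).
  rewrite rx_meet -!rx_comp ka kb; apply/le_meet.
  by split; [apply: (proj2_sig a) | apply: (proj2_sig b)].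
exists (pt_arr (a:=T) (b:=E) (f:=k) lk); split.
  by split; apply: pt_hom_eq.
move=> k' [e1 e2]; apply: pt_hom_eq; apply: ku.
by rewrite -e1 -e2.
Qed.

Hypothesis wdp : has_weak_dependent_products (points P).

(** The weak dependent product of [y], restricted to [(J, j)], along
    [g : (J, j) -> (I, top)].  Quantification along [g] is the case [j = top], and
    implication from [exc_ex g (exc_pr j)] follows by Frobenius. *)
Lemma exc_universal (J I : P) (g : Hom J I) (j : fib P J) (y : fib Q J) :
  exists w : fib Q I, forall z, z ⊑ w <-> rxQ g z ⊓ exc_pr j ⊑ y.
Proof.
move: y; apply: exc_ind => -[B a b].
(* The predicate [b] is cut down by [rx a j] so that [a] becomes an arrow into [(J, j)]. Nothing is
   lost, as [y] is only tested on elements below [exc_pr j]. *)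
pose Xp : points P := MkPt (b ⊓ rx a j); pose Jp : points P := MkPt j.
pose Ip : points P := MkPt (top : fib P I).
pose f : Hom Xp Jp := pt_arr (a:=Xp) (b:=Jp) (meet_ler _ _).
have lg : j ⊑ rx g top by rewrite rx_top; apply: le_top.
pose g' : Hom Jp Ip := pt_arr (a:=Jp) (b:=Ip) lg.
have [d dw] := wdp f g'; exists (exc_cl (MkPreFib (proj1_sig (wd_h d)) (pt_pred (wd_Z d)))).
move=> z; split=> [l|].
  apply: (@le_trans _ _ (rxQ g
    (exc_cl (MkPreFib (proj1_sig (wd_h d)) (pt_pred (wd_Z d)))) ⊓ exc_pr j)).
    by apply: le_meet_mono; [apply: (@rx_le Q) | apply: le_refl].
  (* A generalized element below both conjuncts is a pair of arrows into [(J, j)] and [wd_Z d] over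
     [I], hence an arrow into the pullback [wd_E d]; [wd_e d] then carries it into [y]. *)
  apply: exc_lower => W w m /le_meet [/exc_le_rxQ /exc_clE [k [/= e lk]] /exc_le_pr lj].
  have [sq up] := wd_pullback d.
  pose T : points P := MkPt m.
  pose w' : Hom T Jp := pt_arr (a:=T) (b:=Jp) lj.
  pose k' : Hom T (wd_Z d) := pt_arr (a:=T) (b:=(wd_Z d)) lk.
  have e' : g' ∘ w' = wd_h d ∘ k' by apply: pt_hom_eq.
  have [v [[v1 v2] _]] := up _ _ _ e'.
  apply/exc_clE; exists (proj1_sig (wd_e d ∘ v)) => /=; split.
    have := pt_arr_eq v1; rewrite -(wd_over d) /= => <-.
    by rewrite comp_assoc.
  apply: le_trans (proj2_sig (wd_e d ∘ v)) _; apply: rx_le; exact: meet_lel.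
move: z; apply: exc_ind => -[Z h m] l.
pose Zp : points P := MkPt m.
have lh : m ⊑ rx h top by rewrite rx_top; apply: le_top.
pose h' : Hom Zp Ip := pt_arr (a:=Zp) (b:=Ip) lh.
(* Conversely, the hypothesis applied to the pullback of [g'] and [h'] yields an arrow to [Xp] over
   [Jp], that is, candidate data; weak universality gives the required factorization of [h]. *)
have [E [p [q pbk]]] := pt_pullback g' h'.
have /exc_clE [e [/= ee el]] : exc_cl (MkPreFib (proj1_sig p) (pt_pred E)) ⊑ exc_cl (MkPreFib a b).
  apply: le_trans l; apply/le_meet; split.
    apply/exc_le_rxQ/exc_clE; exists (proj1_sig q) => /=; split.
      exact: (pt_arr_eq (proj1 pbk)).
    exact: (proj2_sig q).
  by apply/exc_le_pr; apply: (proj2_sig p).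
have le : pt_pred E ⊑ rx e (pt_pred Xp).
  rewrite rx_meet -rx_comp -ee; apply/le_meet; split=> //; exact: (proj2_sig p).
pose e' : Hom E Xp := pt_arr (a:=E) (b:=Xp) le.
have ov : f ∘ e' = p by apply: pt_hom_eq; rewrite /= ee.
have [w [k [e1 _]]] := dw (MkWdpData pbk ov).
apply/exc_clE; exists (proj1_sig w) => /=; split; last exact: (proj2_sig w).
exact: (pt_arr_eq e1).
Qed.

Hypothesis gp : has_generic_proof (points P).

Lemma pt_terminal : is_terminal (MkPt (top : fib P (one (lim P))) : points P).
Proof.
move=> A; have [b [_ bu]] := one_terminal (lim P) (pt_base A).
have l : pt_pred A ⊑ rx b top by rewrite rx_top; apply: le_top.
exists (pt_arr (a:=A) (b:=MkPt _) l); split=> // h _; apply: pt_hom_eq.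
exact: bu.
Qed.

(** For a generic proof with codomain [La], the power object of [X] is the base
    of a weak exponential of [La] by [X], that is of a weak dependent product of
    [X × La -> X] along [X -> 1]; membership is the pullback of the generic proof
    along evaluation. *)
Lemma completion_weak_power : has_weak_power_objects Q.
Proof.
move=> X.
have [Th [La [th gen]]] := gp.
pose X1 : points P := MkPt (rx (π2 : Hom (X ×[P] pt_base La) _) (pt_pred La)).
pose Xp : points P := MkPt (top : fib P X).
have l1 : pt_pred X1 ⊑ rx π1 (pt_pred Xp) by rewrite /= rx_top; apply: le_top.
pose f : Hom X1 Xp := pt_arr (a:=X1) (b:=Xp) l1.
have [g _] := pt_terminal Xp.
have [d dw] := wdp f g.
pose Z := pt_base (wd_Z d); pose E0 := pt_base (wd_E d).
pose ev : Hom E0 (pt_base La) := π2 ∘ proj1_sig (wd_e d).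
pose D1 := pb1 (lim P) (proj1_sig th) ev; pose D2 := pb2 (lim P) (proj1_sig th) ev.
have [Dsq Dup] := pb_pullback (lim P) (proj1_sig th) ev; rewrite -/D1 -/D2 in Dsq Dup.
pose pq : Hom E0 (X ×[P] Z) := ⟨proj1_sig (wd_p d), proj1_sig (wd_q d)⟩.
exists Z, (exc_cl (MkPreFib (pq ∘ D2) (rx D1 (pt_pred Th) ⊓ rx D2 (pt_pred (wd_E d))))).
move=> Y; apply: exc_ind => -[B b m].
pose XYp : points P := MkPt (top : fib P (X ×[P] Y)); pose Yp : points P := MkPt (top : fib P Y).
have lb : m ⊑ rx b top by rewrite rx_top; apply: le_top.
(* The pair [(b, m)] is read as a proof of a proposition over [X × Y], and [u] is its name in
   [La]. *)
have [u [Q' [p [q [Qpb [[s es] [t et]]]]]]] := gen (MkPt m) XYp (pt_arr (a:=MkPt m) (b:=XYp) lb).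
have lt1 : (top : fib P (X ×[P] Y)) ⊑ rx π1 (top : fib P X) by rewrite rx_top; apply: le_refl.
have lt2 : (top : fib P (X ×[P] Y)) ⊑ rx π2 (top : fib P Y) by rewrite rx_top; apply: le_refl.
pose q1 : Hom XYp Xp := pt_arr (a:=XYp) (b:=Xp) lt1.
pose q2 : Hom XYp Yp := pt_arr (a:=XYp) (b:=Yp) lt2.
have [h [_ hu]] := pt_terminal Yp.
have pbk : is_pullback g h q1 q2.
  split; first by have [x [_ xu]] := pt_terminal XYp; rewrite -(xu (g ∘ q1)) // -(xu (h ∘ q2)).
  move=> T x y _.
  have lxy : pt_pred T ⊑ rx ⟨proj1_sig x, proj1_sig y⟩ (top : fib P (X ×[P] Y)).
    by rewrite rx_top; apply: le_top.
  exists (pt_arr (a:=T) (b:=XYp) lxy); split.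
    by split; apply: pt_hom_eq; rewrite /= ?pair_pr1 ?pair_pr2.
  move=> k [e1 e2]; apply: pt_hom_eq; rewrite /= -e1 -e2; exact: pair_eta.
have le : pt_pred XYp ⊑ rx ⟨π1, proj1_sig u⟩ (pt_pred X1).
  rewrite /= -rx_comp pair_pr2; exact: (proj2_sig u).
pose e' : Hom XYp X1 := pt_arr (a:=XYp) (b:=X1) le.
have ov : f ∘ e' = q1 by apply: pt_hom_eq; rewrite /= pair_pr1.
(* [X × Y] is the pullback of [X] and [Y] over the terminal object, so [⟨π1, u⟩] is candidate data,
   and [w0] is the exponential transpose of [u]. *)
have [w0 [k0 [_ [[k1' k2'] k3']]]] := dw (MkWdpData pbk ov).
pose w : Hom Yp (wd_Z d) := w0; pose k : Hom XYp (wd_E d) := k0.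
have k1 : wd_p d ∘ k = q1 := k1'; have k2 : wd_q d ∘ k = w ∘ q2 := k2'.
have k3 : e' = wd_e d ∘ k := k3'.
exists (proj1_sig w).
have evk : ev ∘ proj1_sig k = proj1_sig u.
  by rewrite /ev -comp_assoc; have /= <- := pt_arr_eq k3; rewrite pair_pr2.
have pqk : pq ∘ proj1_sig k = ⟨π1, proj1_sig w ∘ π2⟩.
  rewrite /pq pair_comp; congr ⟨_, _⟩.
    exact: (pt_arr_eq k1).
  exact: (pt_arr_eq k2).
have [Esq Eup] := wd_pullback d.
(* The two factorizations supplied by the generic proof give the two inclusions: [s] the first, [t]
   the second. *)
apply: (@le_antisym (fib Q _)); apply: exc_lower => W x n.
  move=> /exc_clE [c [/= -> lc]]; apply/exc_le_rxQ/exc_clE => /=.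
  have eb : proj1_sig u ∘ b = proj1_sig th ∘ proj1_sig (q ∘ s).
    have := pt_arr_eq (proj1 Qpb) => /= e.
    by rewrite comp_assoc -e -comp_assoc; congr comp; apply: (pt_arr_eq es).
  have ey : proj1_sig th ∘ (proj1_sig (q ∘ s) ∘ c) = ev ∘ (proj1_sig k ∘ b ∘ c).
    by rewrite comp_assoc -eb -evk !comp_assoc.
  have [y [[y1 y2] _]] := Dup _ _ _ ey.
  exists y; split; first by rewrite -comp_assoc y2 !comp_assoc pqk.
  rewrite rx_meet -!rx_comp y1 y2 -comp_assoc !rx_comp; apply/le_meet; split.
    by apply: le_trans lc _; apply: rx_le; rewrite -rx_comp; apply: (proj2_sig (q ∘ s)).
  apply: (@le_trans _ _ (rx c (rx b top))); first by rewrite !rx_top; apply: le_top.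
  by do 2 apply: rx_le; apply: (proj2_sig k).
move=> /exc_le_rxQ /exc_clE [c [/= xc]]; rewrite rx_meet -!rx_comp => /le_meet [lc1 lc2].
pose T : points P := MkPt n.
have lx : n ⊑ rx x top by rewrite rx_top; apply: le_top.
pose x' : Hom T XYp := pt_arr (a:=T) (b:=XYp) lx.
pose c1 : Hom T Th := pt_arr (a:=T) (b:=Th) lc1.
pose c2 : Hom T (wd_E d) := pt_arr (a:=T) (b:=wd_E d) lc2.
(* An arrow into the pullback [wd_E d] is determined by its two projections, which [pq] records. *)
have ec : c2 = k ∘ x'.
  have xc' : pq ∘ (D2 ∘ c) = pq ∘ (proj1_sig k ∘ x) by rewrite !comp_assoc -xc pqk.
  have [v [_ vu]] := Eup _ (wd_p d ∘ c2) (wd_q d ∘ c2) (ltac:(by rewrite !comp_assoc Esq)).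
  rewrite -(vu c2) //; apply: vu; split; apply: pt_hom_eq => /=.
    have := f_equal (comp π1) xc'.
    by rewrite /pq !comp_assoc !pair_pr1.
  have := f_equal (comp π2) xc'.
  by rewrite /pq !comp_assoc !pair_pr2.
have ux : u ∘ x' = th ∘ c1.
  apply: pt_hom_eq; have e1 := pt_arr_eq ec.
  apply: (eq_trans (f_equal (fun z => z ∘ x) (eq_sym evk))).
  apply: (eq_trans (eq_sym (comp_assoc _ _ _))); apply: (eq_trans (eq_sym (f_equal (comp ev) e1))).
  by rewrite /= !comp_assoc Dsq.
have [v [[v1 _] _]] := proj2 Qpb _ x' c1 ux.
apply/exc_clE; exists (proj1_sig (t ∘ v)) => /=; split; last exact: (proj2_sig (t ∘ v)).
have := pt_arr_eq v1 => /= <-.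
by rewrite comp_assoc; congr comp; apply: (pt_arr_eq et).
Qed.

Lemma completion_tripos : exists T : FullTripos Q, True.
Proof.
apply: (@full_tripos_intro Q completion_existential) completion_weak_power.
(* By Frobenius [z ∧ ∃_v n] is [∃_v (v^* z ∧ n)], so implication from [∃_v n] is quantification
   along [v] restricted to [n]. *)
- move=> A; elim/exc_ind=> -[V v n] y; have [w h] := exc_universal v n (rxQ v y).
  have e z : z ⊓ exc_cl (MkPreFib v n) = exc_ex v (rxQ v z ⊓ exc_pr n).
    rewrite (exc_clE_ex (MkPreFib v n)) (meetC z) (meetC (rxQ v z)).
    exact: (eq_sym (ex_frobenius completion_existential v (exc_pr n) z)).
  by exists w => z; rewrite h e exc_ex_adj.
- move=> A B f x; have [w h] := exc_universal f top x; exists w => z; rewrite h.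
  suff -> : rxQ f z ⊓ exc_pr top = rxQ f z by [].
  by apply: lower_ext => t; rewrite le_meet; split=> [[]|] // l; split=> //; apply: le_top.
Qed.

End CompletionTripos.

(** * Reasoning with generalized elements *)

Notation "c ⊢ phi [ a , b ]" := (c ⊑ rx ⟨a, b⟩ phi)
  (at level 70, phi at level 9, a at level 60, b at level 60) : cat_scope.

Lemma pull (R : LexDoctrine) (Z Y A : R) (c : fib R Z) (d : fib R Y) (s : Hom Y Z)
    (t : Hom Z A) x :
  d ⊑ rx s c -> c ⊑ rx t x -> d ⊑ rx (t ∘ s) x.
Proof. by move=> l h; rewrite rx_comp; apply: le_trans l _; apply: rx_le. Qed.

Lemma pair_pi (R : LexDoctrine) (A B : R) : ⟨π1, π2⟩ = idm (A ×[R] B).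
Proof. by rewrite -[RHS](pair_eta (lim R)) !comp_idr. Qed.

(* The normal form used for generalized elements: reindexing distributed over meets and collected
   into one arrow, composites associated to the right, pairs computed componentwise. *)
Create HintDb stage.
#[global] Hint Rewrite @rx_meet @pair_comp @pairE1 @pairE2 @comp_idl @comp_idr @pair_eta
  @pair_pi : stage.
#[global] Hint Rewrite <- @rx_comp @comp_assoc : stage.

(** Redefined once products and subobjects of the topos are available. *)
Ltac carriers := idtac.
Ltac norm_in H := carriers; autorewrite with stage in H.
Ltac norm := carriers; autorewrite with stage.

(** Change of stage along [l : d ⊑ rx s c]: restricts the goal and every
    hypothesis [c ⊑ rx t x] along [s], renaming [u ∘ s] to [u]. *)
Ltac push l :=
  lazymatch type of l with
  | @le _ ?d (@rx _ ?Y ?Z ?s ?c) =>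
    repeat match goal with
    | H : le c (rx ?t ?x) |- _ =>
      let H' := fresh "H" in
      pose proof (pull l H) as H'; norm_in H'; clear H; rename H' into H
    end;
    norm;
    repeat match goal with
    | u : Hom Z ?A |- _ =>
      let u' := fresh "u" in
      set (u' := comp u s) in *; clearbody u'; clear u; rename u' into u
    end;
    clear l; try clear c; try clear s; try clear Z
  end.

(** [total], and [decomp] and [image] below, eliminate the existential quantifier of
    a totality condition, a composite and an image, and move to the new stage. *)
Tactic Notation "total" constr(F) constr(H) "as" ident(v) ident(h) :=
  let Y := fresh "Z0" in let s := fresh "stage_map" in let d := fresh "c0" in
  let l := fresh "stage_le" in
  refine (funrel_total F H _); intros Y s v d l h; norm_in h; push l.

Section Rel.
Variables (R : LexDoctrine) (X : FullExistential R).
Notation T := (tripos_to_topos X).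

Implicit Types a b d : T.

Definition rel a b (f : Hom a b) : fib R (tt_car a ×[R] tt_car b) := proj1_sig f.

Lemma rel_funrel a b (f : Hom a b) : is_funrel X (rel f).
Proof. exact: (proj2_sig f). Qed.

End Rel.

Lemma comp_elim (R : LexDoctrine) (X : FullExistential R) (a b d : tripos_to_topos X)
    (g : Hom b d) (f : Hom a b) (Z : R) (c k : fib R Z) u w :
  c ⊢ (rel (g ∘ f)) [u, w] ->
  (forall (Y : R) (s : Hom Y Z) v (c' : fib R Y), c' ⊑ rx s c ->
     c' ⊢ (rel f) [u ∘ s, v] -> c' ⊢ (rel g) [v, w ∘ s] -> c' ⊑ rx s k) ->
  c ⊑ k.
Proof. exact: rel_comp_elim. Qed.

Tactic Notation "decomp" constr(H) "as" ident(v) ident(h1) ident(h2) :=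
  let Y := fresh "Z0" in let s := fresh "stage_map" in let d := fresh "c0" in
  let l := fresh "stage_le" in
  lazymatch type of H with
  | context [@rel ?R ?X ?a ?b (@comp _ _ ?e _ ?g ?f)] =>
    refine (@comp_elim R X a e b g f _ _ _ _ _ H _)
  | _ => refine (rel_comp_elim H _)
  end; intros Y s v d l h1 h2; norm_in h1; norm_in h2; push l.

Definition conv (R : LexDoctrine) (A B : R) (x : fib R (A ×[R] B)) :
  fib R (B ×[R] A) := rx ⟨π2, π1⟩ x.

Lemma convE (R : LexDoctrine) (A B Z : R) (x : fib R (A ×[R] B)) (u : Hom Z B) (v : Hom Z A) :
  rx ⟨u, v⟩ (conv x) = rx ⟨v, u⟩ x.
Proof. by rewrite /conv; norm. Qed.
#[global] Hint Rewrite @convE : stage.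

Section FiniteLimits.
Variables (R : LexDoctrine) (X : FullExistential R).
Notation T := (tripos_to_topos X).
Implicit Types a b d : T.

(** One inclusion suffices for functional relations: totality of [f] provides a value, and
    single-valuedness of [g] identifies it with the given one. *)
Lemma rel_ext a b (f g : Hom a b) :
  (forall (Z : R) (c : fib R Z) u v, c ⊢ (rel f) [u, v] -> c ⊢ (rel g) [u, v]) -> f = g.
Proof.
move=> h; apply: tt_hom_eq; apply: le_antisym; apply: rel_le => // Z c u v k.
have [ka _] := funrel_strict (rel_funrel g) k.
total (rel_funrel f) ka as w l.
apply: (funrel_right (rel_funrel f) _ l).
exact: (funrel_single (rel_funrel g)) (h _ _ _ _ l) k.
Qed.

Definition rel_hom a b phi (F : @is_funrel R X a b phi) : Hom a b := exist _ phi F.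

Lemma force_le (A B Z : R) (x y : fib R (A ×[R] B)) (c : fib R Z) u v :
  x ⊑ y -> c ⊢ x [u, v] -> c ⊢ y [u, v].
Proof. by move=> l h; apply: le_trans h _; apply: rx_le. Qed.

Lemma total_intro (A B Z : R) (x : fib R (A ×[R] B)) (c : fib R Z) u v :
  c ⊢ x [u, v] -> c ⊑ rx u (ex X π1 x).
Proof. by move=> h; have := ex_intro_rx X π1 h; rewrite pairE1. Qed.

Lemma comp_intro a b d (g : Hom b d) (f : Hom a b) (Z : R) (c : fib R Z) u v w :
  c ⊢ (rel f) [u, v] -> c ⊢ (rel g) [v, w] -> c ⊢ (rel (g ∘ f)) [u, w].
Proof. exact: rel_comp_intro. Qed.

Lemma comp_eq a b b' d (g : Hom b d) (f : Hom a b) (g' : Hom b' d) (f' : Hom a b')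
    (Z : R) (c : fib R Z) u v w :
  g ∘ f = g' ∘ f' -> c ⊢ (rel f) [u, v] -> c ⊢ (rel g) [v, w] ->
  c ⊢ (rel (g' ∘ f')) [u, w].
Proof. by move=> <-; apply: comp_intro. Qed.

(** * Finite limits and power objects of the topos *)

(** Uniqueness and existence of an element, written as inequalities between terms built from
    reindexing, meets and [∃]. A functor induced by a fibrewise map that commutes with these
    operations preserves them. *)
Record terminal_conditions (t : T) : Prop := MkTerminalConditions {
  tc_unique : rx ⟨π1, π1⟩ (tt_eq t) ⊓ rx ⟨π2, π2⟩ (tt_eq t) ⊑ tt_eq t;
  tc_inhabited : forall b : Hom (tt_car t) (one (lim R)),
    top ⊑ ex X b (rx ⟨idm _, idm _⟩ (tt_eq t))
}.

Lemma tc_unique_force t (Z : R) (c : fib R Z) u v : terminal_conditions t ->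
  c ⊢ (tt_eq t) [u, u] -> c ⊢ (tt_eq t) [v, v] -> c ⊢ (tt_eq t) [u, v].
Proof.
by move=> [h _] h1 h2; apply: (force_le h); norm; apply/le_meet.
Qed.

Lemma tc_inhabited_elim t (Z : R) (c g : fib R Z) : terminal_conditions t ->
  (forall (Y : R) (s : Hom Y Z) v (c' : fib R Y), c' ⊑ rx s c -> c' ⊢ (tt_eq t) [v, v] ->
     c' ⊑ rx s g) -> c ⊑ g.
Proof.
move=> [_ h] k.
have [b _] := one_terminal (lim R) (tt_car t).
have [z _] := one_terminal (lim R) Z.
have h' : c ⊑ rx z (ex X b (rx ⟨idm _, idm _⟩ (tt_eq t))).
  apply: (@le_trans _ _ (rx z top)); first by rewrite rx_top; apply: le_top.
  by apply: rx_le; apply: h.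
apply: (ex_elim h') => Y s u c' _ l h2; apply: (k _ _ u) => //.
by move: h2; norm.
Qed.

Lemma terminal_of_conditions t : terminal_conditions t -> is_terminal t.
Proof.
move=> tc a.
have F : @is_funrel R X a t (rx ⟨π1, π1⟩ (tt_eq a) ⊓ rx ⟨π2, π2⟩ (tt_eq t)).
  { apply: funrel_intro => Z c.
  - by move=> u v; norm => /le_meet.
  - move=> u u' v h; norm => /le_meet [h1 h2]; apply/le_meet; split=> //.
    exact: per_trans (per_sym h) h.
  - move=> u v v' h; norm => /le_meet [h1 h2]; apply/le_meet; split=> //.
    exact: per_trans (per_sym h) h.
  - move=> u v v'; norm => /le_meet [h1 h2] /le_meet [h3 h4].
    exact: tc_unique_force.
  - move=> u h; apply: (tc_inhabited_elim tc) => Y s v c' l k; push l.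
    by apply: (@total_intro _ _ _ _ _ _ v); norm; apply/le_meet. }
exists (rel_hom F); split=> // f _; apply: rel_ext => Z c u v.
rewrite /rel /=; norm => /le_meet [h1 h2].
total (rel_funrel f) h1 as w h3.
apply: (funrel_right (rel_funrel f) _ h3).
have [_ h4] := funrel_strict (rel_funrel f) h3.
exact: tc_unique_force.
Qed.

Definition tt_one : T.
Proof. by apply: (@MkTT R (one (lim R)) top); split; rewrite !rx_top; apply: le_top. Defined.

Lemma tt_one_conditions : terminal_conditions tt_one.
Proof.
split; first exact: le_top.
move=> b; have [i [_ iu]] := one_terminal (lim R) (one (lim R)).
rewrite -(iu b) // (iu (idm _)) //; rewrite -[X in _ ⊑ X]rx_id /= rx_top.
by apply/(ex_adj X); apply: le_refl.
Qed.

(** The conditions hold for [tt_one] and are transported along the isomorphism between two terminal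
    objects. *)
Lemma conditions_of_terminal t : is_terminal t -> terminal_conditions t.
Proof.
move=> tt; have tt1 := terminal_of_conditions tt_one_conditions.
have [f _] := tt1 t; have [g _] := tt tt_one.
have e : g ∘ f = idm t by have [x [_ xu]] := tt t; rewrite -(xu (g ∘ f)) // -(xu (idm t)).
split.
  apply: rel_le => Z c u v; norm => /le_meet [h1 h2].
  total (rel_funrel f) h1 as w k1.
  total (rel_funrel f) h2 as w' k2.
  have [_ h3] := funrel_strict (rel_funrel f) k1.
  have [_ h4] := funrel_strict (rel_funrel f) k2.
  total (rel_funrel g) h3 as x k3.
  have h5 := tc_unique_force tt_one_conditions h3 h4.
  have k4 := funrel_left (rel_funrel g) h5 k3.
  have := comp_intro k1 k3; have := comp_intro k2 k4; rewrite e => h6 h7.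
  exact: per_trans h7 (per_sym h6).
move=> b; apply: (tc_inhabited_elim tt_one_conditions) => Y s v c' _ k.
refine (funrel_total (rel_funrel g) k _) => Y' s' x d l h.
have [_ h3] := funrel_strict (rel_funrel g) h.
rewrite -rx_comp; have [z [_ zu]] := one_terminal (lim R) Y'.
rewrite -(zu (s ∘ s')) // (zu (b ∘ x)) //.
by apply: ex_intro_rx; norm.
Qed.

(** Like [jointly_full] below, this is phrased with composition, converse and meet of relations
    only, so that it is visibly regular. *)
Definition jointly_monic a b d (p : Hom d a) (q : Hom d b) : Prop :=
  rel_comp X (conv (rel p)) (rel p) ⊓ rel_comp X (conv (rel q)) (rel q) ⊑ tt_eq d.

Lemma jointly_monic_force a b d (p : Hom d a) (q : Hom d b) (Z : R) (c : fib R Z)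
    u v x y : jointly_monic p q ->
  c ⊢ (rel p) [u, x] -> c ⊢ (rel q) [u, y] -> c ⊢ (rel p) [v, x] ->
  c ⊢ (rel q) [v, y] -> c ⊢ (tt_eq d) [u, v].
Proof.
move=> h h1 h2 h3 h4; apply: (force_le h); norm; apply/le_meet; split.
  by apply: (rel_comp_intro X h1); rewrite convE.
by apply: (rel_comp_intro X h2); rewrite convE.
Qed.

Lemma jointly_monic_intro a b d (p : Hom d a) (q : Hom d b) :
  (forall (Z : R) (c : fib R Z) u v x y,
    c ⊢ (rel p) [u, x] -> c ⊢ (rel q) [u, y] -> c ⊢ (rel p) [v, x] ->
    c ⊢ (rel q) [v, y] -> c ⊢ (tt_eq d) [u, v]) -> jointly_monic p q.
Proof.
move=> h; apply: rel_le => Z c u v; norm => /le_meet [h1 h2].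
decomp h1 as x k1 k2.
decomp h2 as y k3 k4.
exact: h k1 k3 k2 k4.
Qed.

Definition jointly_full a b d e (f : Hom a e) (g : Hom b e) (p : Hom d a) (q : Hom d b) :
    Prop :=
  rel_comp X (conv (rel g)) (rel f) ⊑ rel_comp X (rel q) (conv (rel p)).

Lemma jointly_full_force a b d e (f : Hom a e) (g : Hom b e) (p : Hom d a) (q : Hom d b)
    (Z : R) (c : fib R Z) x y z : jointly_full f g p q ->
  c ⊢ (rel f) [x, z] -> c ⊢ (rel g) [y, z] ->
  c ⊢ (rel_comp X (rel q) (conv (rel p))) [x, y].
Proof.
move=> h h1 h2; apply: (force_le h).
by apply: (rel_comp_intro X h1); rewrite convE.
Qed.

Lemma jointly_full_intro a b d e (f : Hom a e) (g : Hom b e) (p : Hom d a) (q : Hom d b) :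
  (forall (Z : R) (c : fib R Z) x y z, c ⊢ (rel f) [x, z] -> c ⊢ (rel g) [y, z] ->
    c ⊢ (rel_comp X (rel q) (conv (rel p))) [x, y]) -> jointly_full f g p q.
Proof.
move=> h; apply: rel_le => Z c x y k.
decomp k as z k1 k2; exact: h k1 k2.
Qed.

Lemma pullback_of_conditions a b d e (f : Hom a e) (g : Hom b e) (p : Hom d a)
    (q : Hom d b) :
  f ∘ p = g ∘ q -> jointly_monic p q -> jointly_full f g p q -> is_pullback f g p q.
Proof.
move=> sq jm jf; split=> // z s t st.
(* The mediating relation says [s w = p u] and [t w = q u]. It is single-valued by [jm] and total by
   [jf]. *)
pose phi := rel_comp X (conv (rel p)) (rel s) ⊓ rel_comp X (conv (rel q)) (rel t).
have phi_in (Z : R) (c : fib R Z) w u x y : c ⊢ (rel s) [w, x] -> c ⊢ (rel p) [u, x] ->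
    c ⊢ (rel t) [w, y] -> c ⊢ (rel q) [u, y] -> c ⊢ phi [w, u].
  move=> h1 h2 h3 h4; rewrite /phi; norm; apply/le_meet; split.
    by apply: (rel_comp_intro X h1); rewrite convE.
  by apply: (rel_comp_intro X h3); rewrite convE.
have phi_out (Z : R) (c g' : fib R Z) w u : c ⊢ phi [w, u] ->
  (forall (Y : R) (s0 : Hom Y Z) x y (c' : fib R Y), c' ⊑ rx s0 c ->
    c' ⊢ (rel s) [w ∘ s0, x] -> c' ⊢ (rel p) [u ∘ s0, x] ->
    c' ⊢ (rel t) [w ∘ s0, y] -> c' ⊢ (rel q) [u ∘ s0, y] -> c' ⊑ rx s0 g') -> c ⊑ g'.
  { rewrite /phi; norm => /le_meet [h1 h2] k.
  refine (rel_comp_elim h1 _) => Y s0 x c' l1 h3; rewrite convE => h4.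
  refine (rel_comp_elim (entails_rx l1 h2) _) => Y' s1 y c'' l2 h5; rewrite convE => h6.
  rewrite -rx_comp; apply: (k Y' (s0 ∘ s1) (x ∘ s1) y c''); rewrite ?comp_assoc //.
  - by rewrite rx_comp; apply: le_trans l2 _; apply: rx_le.
  - exact: entails_rx l2 h3.
  - exact: entails_rx l2 h4. }
clearbody phi.
have F : @is_funrel R X z d phi.
  { apply: funrel_intro => Z c.
  - move=> w u h; split; apply: (phi_out _ _ _ _ _ h) => Y s0 x y c' l h1 h2 h3 h4.
    + by rewrite -rx_comp pair_comp; have [] := funrel_strict (rel_funrel s) h1.
    + by rewrite -rx_comp pair_comp; have [] := funrel_strict (rel_funrel p) h2.
  - move=> w w' u e1 h; apply: (phi_out _ _ _ _ _ h) => Y s0 x y c' l h1 h2 h3 h4.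
    push l; apply: phi_in (funrel_left (rel_funrel s) e1 h1) h2 _ h4.
    exact: (funrel_left (rel_funrel t) e1 h3).
  - move=> w u u' e1 h; apply: (phi_out _ _ _ _ _ h) => Y s0 x y c' l h1 h2 h3 h4.
    push l; apply: phi_in h1 (funrel_left (rel_funrel p) e1 h2) h3 _.
    exact: (funrel_left (rel_funrel q) e1 h4).
  - move=> w u u' h h'; apply: (phi_out _ _ _ _ _ h) => Y s0 x y c' l h1 h2 h3 h4.
    push l; apply: (phi_out _ _ _ _ _ h') => Y' s1 x' y' c'' l h1' h2' h3' h4'.
    push l; apply: (jointly_monic_force jm h2 h4).
      exact: (funrel_right (rel_funrel p) (funrel_single (rel_funrel s) h1' h1) h2').
    exact: (funrel_right (rel_funrel q) (funrel_single (rel_funrel t) h3' h3) h4').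
  - move=> w h; total (rel_funrel s) h as x h1; total (rel_funrel t) h as y h2.
    have [_ hx] := funrel_strict (rel_funrel s) h1.
    total (rel_funrel f) hx as v h3.
    have := comp_eq st h1 h3 => k; decomp k as y' k1 k2.
    have k3 := funrel_left (rel_funrel g) (funrel_single (rel_funrel t) k1 h2) k2.
    have k4 := jointly_full_force jf h3 k3.
    decomp k4 as u k5 k6.
    apply: total_intro; exact: phi_in h1 k5 h2 k6. }
have ps : p ∘ rel_hom F = s.
  apply: rel_ext => Z c w x k; decomp k as u k1 k2.
  apply: (phi_out _ _ _ _ _ k1) => Y s0 x' y' c' l h1 h2 h3 h4; push l.
  exact: (funrel_right (rel_funrel s) (funrel_single (rel_funrel p) h2 k2) h1).
have qt : q ∘ rel_hom F = t.
  apply: rel_ext => Z c w x k; decomp k as u k1 k2.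
  apply: (phi_out _ _ _ _ _ k1) => Y s0 x' y' c' l h1 h2 h3 h4; push l.
  exact: (funrel_right (rel_funrel t) (funrel_single (rel_funrel q) h4 k2) h3).
exists (rel_hom F); split=> // h [hp hq]; apply: rel_ext => Z c w u k.
apply: (phi_out _ _ _ _ _ k) => Y s0 x y c' l h1 h2 h3 h4; push l.
rewrite -hp in h1; rewrite -hq in h3.
decomp h1 as v k1 k2; decomp h3 as v' k3 k4.
have e1 := funrel_left (rel_funrel q) (funrel_single (rel_funrel h) k3 k1) k4.
apply: (funrel_right (rel_funrel h) _ k1).
exact: (jointly_monic_force jm k2 e1 h2 h4).
Qed.


Lemma per_intro (A : R) (rho : fib R (A ×[R] A)) :
  (forall (Z : R) (c : fib R Z) u v, c ⊢ rho [u, v] -> c ⊢ rho [v, u]) ->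
  (forall (Z : R) (c : fib R Z) u v w, c ⊢ rho [u, v] -> c ⊢ rho [v, w] -> c ⊢ rho [u, w]) ->
  is_per rho.
Proof.
move=> h1 h2; split.
  by apply: rel_le => Z c u v h; norm; apply: h1.
exact: h2 (meet_lel _ _) (meet_ler _ _).
Qed.

Definition prod_eq a b : fib R (tt_car a ×[R] tt_car b ×[R] (tt_car a ×[R] tt_car b)) :=
  rx ⟨π1 ∘ π1, π1 ∘ π2⟩ (tt_eq a) ⊓ rx ⟨π2 ∘ π1, π2 ∘ π2⟩ (tt_eq b).

Lemma prod_eqE a b (Z : R) (c : fib R Z) u v :
  c ⊢ (prod_eq a b) [u, v] <->
  c ⊢ (tt_eq a) [π1 ∘ u, π1 ∘ v] /\ c ⊢ (tt_eq b) [π2 ∘ u, π2 ∘ v].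
Proof. by rewrite /prod_eq; norm; apply: le_meet. Qed.

Lemma prod_per a b : is_per (prod_eq a b).
Proof.
apply: per_intro => Z c u v.
  by rewrite !prod_eqE => -[h1 h2]; split; apply: per_sym.
by move=> w; rewrite !prod_eqE => -[h1 h2] [h3 h4]; split; apply: per_trans; eauto.
Qed.

Definition tt_prod a b : T := MkTT (prod_per a b).

Lemma tt_prodE a b (Z : R) (c : fib R Z) u v :
  c ⊢ (tt_eq (tt_prod a b)) [u, v] <->
  c ⊢ (tt_eq a) [π1 ∘ u, π1 ∘ v] /\ c ⊢ (tt_eq b) [π2 ∘ u, π2 ∘ v].
Proof. exact: prod_eqE. Qed.
End FiniteLimits.

(** * Binary products and subobjects in the topos *)

Section Products.
Variables (R : LexDoctrine) (X : FullExistential R).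
Notation T := (tripos_to_topos X).
Implicit Types a b d : T.
Definition fst_rel a b : fib R (tt_car (tt_prod a b) ×[R] tt_car a) :=
  rx ⟨π1 ∘ π1, π2⟩ (tt_eq a) ⊓ rx ⟨π2 ∘ π1, π2 ∘ π1⟩ (tt_eq b).

Definition snd_rel a b : fib R (tt_car (tt_prod a b) ×[R] tt_car b) :=
  rx ⟨π1 ∘ π1, π1 ∘ π1⟩ (tt_eq a) ⊓ rx ⟨π2 ∘ π1, π2⟩ (tt_eq b).

Definition pair_rel d a b (f : Hom d a) (g : Hom d b) :
    fib R (tt_car d ×[R] tt_car (tt_prod a b)) :=
  rx ⟨π1, π1 ∘ π2⟩ (rel f) ⊓ rx ⟨π1, π2 ∘ π2⟩ (rel g).

Lemma fst_relE a b (Z : R) (c : fib R Z) u x :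
  c ⊢ (fst_rel a b) [u, x] <-> c ⊢ (tt_eq a) [π1 ∘ u, x] /\ c ⊢ (tt_eq b) [π2 ∘ u, π2 ∘ u].
Proof. by rewrite /fst_rel; norm; apply: le_meet. Qed.

Lemma snd_relE a b (Z : R) (c : fib R Z) u x :
  c ⊢ (snd_rel a b) [u, x] <-> c ⊢ (tt_eq a) [π1 ∘ u, π1 ∘ u] /\ c ⊢ (tt_eq b) [π2 ∘ u, x].
Proof. by rewrite /snd_rel; norm; apply: le_meet. Qed.

Lemma pair_relE d a b (f : Hom d a) (g : Hom d b) (Z : R) (c : fib R Z) z u :
  c ⊢ (pair_rel f g) [z, u] <-> c ⊢ (rel f) [z, π1 ∘ u] /\ c ⊢ (rel g) [z, π2 ∘ u].
Proof. by rewrite /pair_rel; norm; apply: le_meet. Qed.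

Lemma per_refl_l a (Z : R) (c : fib R Z) u v :
  c ⊢ (tt_eq a) [u, v] -> c ⊢ (tt_eq a) [u, u].
Proof. by move=> h; apply: per_trans h (per_sym h). Qed.

Lemma per_refl_r a (Z : R) (c : fib R Z) u v :
  c ⊢ (tt_eq a) [u, v] -> c ⊢ (tt_eq a) [v, v].
Proof. by move=> h; apply: per_trans (per_sym h) h. Qed.

Lemma fst_funrel a b : @is_funrel R X (tt_prod a b) a (fst_rel a b).
Proof.
apply: funrel_intro => Z c.
- move=> u x /fst_relE [h1 h2]; rewrite tt_prodE; split; [split|] => //.
    exact: per_refl_l h1.
  exact: per_refl_r h1.
- move=> u u' x /tt_prodE [h1 h2] /fst_relE [h3 h4]; apply/fst_relE; split.
    exact: per_trans (per_sym h1) h3.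
  exact: per_refl_r h2.
- move=> u x x' h1 /fst_relE [h3 h4]; apply/fst_relE; split=> //.
  exact: per_trans h3 h1.
- move=> u x x' /fst_relE [h1 _] /fst_relE [h3 h4].
  exact: per_trans (per_sym h1) h3.
- by move=> u /tt_prodE [h1 h2]; apply: (@total_intro _ _ _ _ _ _ _ _ (π1 ∘ u)); apply/fst_relE.
Qed.

Lemma snd_funrel a b : @is_funrel R X (tt_prod a b) b (snd_rel a b).
Proof.
apply: funrel_intro => Z c.
- move=> u x /snd_relE [h1 h2]; rewrite tt_prodE; split; [split|] => //.
    exact: per_refl_l h2.
  exact: per_refl_r h2.
- move=> u u' x /tt_prodE [h1 h2] /snd_relE [h3 h4]; apply/snd_relE; split.
    exact: per_refl_r h1.
  exact: per_trans (per_sym h2) h4.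
- move=> u x x' h1 /snd_relE [h3 h4]; apply/snd_relE; split=> //.
  exact: per_trans h4 h1.
- move=> u x x' /snd_relE [h1 h2] /snd_relE [h3 h4].
  exact: per_trans (per_sym h2) h4.
- by move=> u /tt_prodE [h1 h2]; apply: (@total_intro _ _ _ _ _ _ _ _ (π2 ∘ u)); apply/snd_relE.
Qed.

Lemma pair_funrel d a b (f : Hom d a) (g : Hom d b) :
  @is_funrel R X d (tt_prod a b) (pair_rel f g).
Proof.
have F := rel_funrel f; have G := rel_funrel g.
apply: funrel_intro => Z c.
- move=> z u /pair_relE [h1 h2]; have [? ?] := funrel_strict F h1.
  have [? ?] := funrel_strict G h2; split=> //; exact/tt_prodE.
- move=> z z' u e /pair_relE [h1 h2]; apply/pair_relE; split.
    exact: (funrel_left F) e h1.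
  exact: (funrel_left G) e h2.
- move=> z u u' /tt_prodE [e1 e2] /pair_relE [h1 h2]; apply/pair_relE; split.
    exact: (funrel_right F) e1 h1.
  exact: (funrel_right G) e2 h2.
- move=> z u u' /pair_relE [h1 h2] /pair_relE [h3 h4]; apply/tt_prodE; split.
    exact: (funrel_single F) h1 h3.
  exact: (funrel_single G) h2 h4.
- move=> z h; total F h as x h1; total G h as y h2.
  apply: (@total_intro _ _ _ _ _ _ _ _ ⟨x, y⟩); apply/pair_relE.
  by norm.
Qed.

Definition tt_fst a b : Hom (tt_prod a b) a := rel_hom (fst_funrel a b).
Definition tt_snd a b : Hom (tt_prod a b) b := rel_hom (snd_funrel a b).
Definition tt_pair d a b (f : Hom d a) (g : Hom d b) : Hom d (tt_prod a b) :=
  rel_hom (pair_funrel f g).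

Lemma tt_fstE a b (Z : R) (c : fib R Z) u x :
  c ⊢ (rel (tt_fst a b)) [u, x] <->
  c ⊢ (tt_eq a) [π1 ∘ u, x] /\ c ⊢ (tt_eq b) [π2 ∘ u, π2 ∘ u].
Proof. exact: fst_relE. Qed.

Lemma tt_sndE a b (Z : R) (c : fib R Z) u x :
  c ⊢ (rel (tt_snd a b)) [u, x] <->
  c ⊢ (tt_eq a) [π1 ∘ u, π1 ∘ u] /\ c ⊢ (tt_eq b) [π2 ∘ u, x].
Proof. exact: snd_relE. Qed.

Lemma tt_pairE d a b (f : Hom d a) (g : Hom d b) (Z : R) (c : fib R Z) z u :
  c ⊢ (rel (tt_pair f g)) [z, u] <-> c ⊢ (rel f) [z, π1 ∘ u] /\ c ⊢ (rel g) [z, π2 ∘ u].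
Proof. exact: pair_relE. Qed.

Lemma tt_pair_fst d a b (f : Hom d a) (g : Hom d b) : tt_fst a b ∘ tt_pair f g = f.
Proof.
apply: rel_ext => Z c z x h; decomp h as u h1 h2.
move/tt_pairE: h1 => [h1 _]; move/tt_fstE: h2 => [h2 _].
exact: (funrel_right (rel_funrel f) h2 h1).
Qed.

Lemma tt_pair_snd d a b (f : Hom d a) (g : Hom d b) : tt_snd a b ∘ tt_pair f g = g.
Proof.
apply: rel_ext => Z c z x h; decomp h as u h1 h2.
move/tt_pairE: h1 => [_ h1]; move/tt_sndE: h2 => [_ h2].
exact: (funrel_right (rel_funrel g) h2 h1).
Qed.

Lemma tt_pair_eta d a b (h : Hom d (tt_prod a b)) :
  tt_pair (tt_fst a b ∘ h) (tt_snd a b ∘ h) = h.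
Proof.
apply: eq_sym; apply: rel_ext => Z c z u k.
have [_ /tt_prodE [h1 h2]] := funrel_strict (rel_funrel h) k.
apply/tt_pairE; split; apply: (comp_intro k).
  exact/tt_fstE.
exact/tt_sndE.
Qed.

Definition is_sub d (k : fib R (tt_car d)) : Prop :=
  forall (Z : R) (c : fib R Z) u v, c ⊑ rx u k -> c ⊢ (tt_eq d) [u, v] -> c ⊑ rx v k.

(** Restricting the left argument restricts both, because [k] is stable under equality. *)
Definition sub_eq d (k : fib R (tt_car d)) := tt_eq d ⊓ rx π1 k.

Lemma sub_eqE d (k : fib R (tt_car d)) (Z : R) (c : fib R Z) u v :
  c ⊢ (sub_eq k) [u, v] <-> c ⊢ (tt_eq d) [u, v] /\ c ⊑ rx u k.
Proof. by rewrite /sub_eq; norm; apply: le_meet. Qed.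

Lemma sub_per d (k : fib R (tt_car d)) : is_sub k -> is_per (sub_eq k).
Proof.
move=> hk; apply: per_intro => Z c u v.
  move=> /sub_eqE [h1 h2]; apply/sub_eqE; split; first exact: per_sym.
  exact: hk h2 h1.
move=> w /sub_eqE [h1 h2] /sub_eqE [h3 _]; apply/sub_eqE; split=> //.
exact: per_trans h1 h3.
Qed.

Definition tt_sub d (k : fib R (tt_car d)) (hk : is_sub k) : T := MkTT (sub_per hk).

Lemma sub_funrel d (k : fib R (tt_car d)) (hk : is_sub k) :
  @is_funrel R X (tt_sub hk) d (sub_eq k).
Proof.
have out (Z : R) (c : fib R Z) u v :
  c ⊢ (sub_eq k) [u, v] -> c ⊢ (tt_eq d) [u, v] /\ c ⊑ rx u k := proj1 (sub_eqE k c u v).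
apply: funrel_intro => Z c.
- move=> u v h; split; first exact: (per_refl_l (a := tt_sub hk)) h.
  exact: per_refl_r (proj1 (out _ _ _ _ h)).
- by move=> u u' v h1 h2; apply: (per_trans (a := tt_sub hk)) (per_sym h1) h2.
- move=> u v v' h /out [h1 h2]; apply/(@sub_eqE d); split=> //.
  exact: per_trans h1 h.
- move=> u v v' /out [h1 _] /out [h2 _]; exact: per_trans (per_sym h1) h2.
- by move=> u h; apply: (@total_intro _ _ _ _ _ _ _ _ u).
Qed.

Definition tt_incl d (k : fib R (tt_car d)) (hk : is_sub k) : Hom (tt_sub hk) d :=
  rel_hom (sub_funrel hk).

Lemma tt_subE d (k : fib R (tt_car d)) (hk : is_sub k) (Z : R) (c : fib R Z) u v :
  c ⊢ (tt_eq (tt_sub hk)) [u, v] <-> c ⊢ (tt_eq d) [u, v] /\ c ⊑ rx u k.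
Proof. exact: (@sub_eqE d k). Qed.

Lemma tt_inclE d (k : fib R (tt_car d)) (hk : is_sub k) (Z : R) (c : fib R Z) u v :
  c ⊢ (rel (tt_incl hk)) [u, v] <-> c ⊢ (tt_eq d) [u, v] /\ c ⊑ rx u k.
Proof. exact: (@sub_eqE d k). Qed.

End Products.

Ltac carriers ::=
  repeat match goal with
  | |- context [@tt_car _ (@tt_prod ?R ?X ?a ?b)] =>
    change (@tt_car R (@tt_prod R X a b)) with (prd (lim R) (@tt_car R a) (@tt_car R b)) in *
  | |- context [@tt_car _ (@tt_sub ?R ?X ?d ?k ?hk)] =>
    change (@tt_car R (@tt_sub R X d k hk)) with (@tt_car R d) in *
  | H : context [@tt_car _ (@tt_prod ?R ?X ?a ?b)] |- _ =>
    change (@tt_car R (@tt_prod R X a b)) with (prd (lim R) (@tt_car R a) (@tt_car R b)) in *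
  | H : context [@tt_car _ (@tt_sub ?R ?X ?d ?k ?hk)] |- _ =>
    change (@tt_car R (@tt_sub R X d k hk)) with (@tt_car R d) in *
  end.

Ltac through v :=
  lazymatch goal with
  | |- context [@rel ?R ?X ?a ?d (@comp _ _ ?b _ ?g ?f)] =>
    refine (@comp_intro R X a b d g f _ _ _ v _ _ _)
  end.

Ltac view_in H :=
  lazymatch type of H with
  | context [@rel _ _ _ _ (@tt_fst ?R ?X ?a ?b)] => apply (proj1 (@tt_fstE R X a b _ _ _ _)) in H
  | context [@rel _ _ _ _ (@tt_snd ?R ?X ?a ?b)] => apply (proj1 (@tt_sndE R X a b _ _ _ _)) in H
  | context [@rel _ _ _ _ (@tt_pair ?R ?X ?d ?a ?b ?f ?g)] =>
    apply (proj1 (@tt_pairE R X d a b f g _ _ _ _)) in H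
  | context [@rel _ _ _ _ (@tt_incl ?R ?X ?d ?k ?hk)] =>
    apply (proj1 (@tt_inclE R X d k hk _ _ _ _)) in H
  | context [@tt_eq _ (@tt_prod ?R ?X ?a ?b)] => apply (proj1 (@tt_prodE R X a b _ _ _ _)) in H
  | context [@tt_eq _ (@tt_sub ?R ?X ?d ?k ?hk)] =>
    apply (proj1 (@tt_subE R X d k hk _ _ _ _)) in H
  end; norm_in H.

Ltac view :=
  lazymatch goal with
  | |- context [@rel _ _ _ _ (@tt_fst ?R ?X ?a ?b)] => apply (proj2 (@tt_fstE R X a b _ _ _ _))
  | |- context [@rel _ _ _ _ (@tt_snd ?R ?X ?a ?b)] => apply (proj2 (@tt_sndE R X a b _ _ _ _))
  | |- context [@rel _ _ _ _ (@tt_pair ?R ?X ?d ?a ?b ?f ?g)] =>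
    apply (proj2 (@tt_pairE R X d a b f g _ _ _ _))
  | |- context [@rel _ _ _ _ (@tt_incl ?R ?X ?d ?k ?hk)] =>
    apply (proj2 (@tt_inclE R X d k hk _ _ _ _))
  | |- context [@tt_eq _ (@tt_prod ?R ?X ?a ?b)] => apply (proj2 (@tt_prodE R X a b _ _ _ _))
  | |- context [@tt_eq _ (@tt_sub ?R ?X ?d ?k ?hk)] =>
    apply (proj2 (@tt_subE R X d k hk _ _ _ _))
  end; norm.

(** * Pullbacks, monos and images in the topos *)

Section Subobjects.
Variables (R : LexDoctrine) (X : FullExistential R).
Notation T := (tripos_to_topos X).
Implicit Types a b d : T.
Lemma prod_elt (A B Z : R) (u : Hom Z (A ×[R] B)) : exists x y, u = ⟨x, y⟩.
Proof. by exists (π1 ∘ u), (π2 ∘ u); rewrite pair_eta. Qed.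

Lemma fst_inclE a b k (hk : @is_sub _ X (tt_prod a b) k) (Z : R) (c : fib R Z) x y x' :
  c ⊢ (rel (tt_fst a b ∘ tt_incl hk)) [⟨x, y⟩, x'] <->
  [/\ c ⊢ (tt_eq a) [x, x'], c ⊢ (tt_eq b) [y, y] & c ⊑ rx ⟨x, y⟩ k].
Proof.
split=> [h|[h1 h2 h3]]; last first.
  through ⟨x, y⟩; view=> //; split=> //; view; split=> //; exact: per_refl_l h1.
split; decomp h as u h1 h2; view_in h1; move: h1 => [h1 h3]; view_in h1; view_in h2.
- exact: per_trans (proj1 h1) (proj1 h2).
- exact: per_refl_l (proj2 h1).
- exact: h3.
Qed.

Lemma snd_inclE a b k (hk : @is_sub _ X (tt_prod a b) k) (Z : R) (c : fib R Z) x y y' :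
  c ⊢ (rel (tt_snd a b ∘ tt_incl hk)) [⟨x, y⟩, y'] <->
  [/\ c ⊢ (tt_eq a) [x, x], c ⊢ (tt_eq b) [y, y'] & c ⊑ rx ⟨x, y⟩ k].
Proof.
split=> [h|[h1 h2 h3]]; last first.
  through ⟨x, y⟩; view=> //; split=> //; view; split=> //; exact: per_refl_l h2.
split; decomp h as u h1 h2; view_in h1; move: h1 => [h1 h3]; view_in h1; view_in h2.
- exact: per_refl_l (proj1 h1).
- exact: per_trans (proj2 h1) (proj2 h2).
- exact: h3.
Qed.

(** The predicate [f x = g y] on pairs, which carves the pullback out of the product. *)
Lemma pullback_sub a b e (f : Hom a e) (g : Hom b e) :
  @is_sub _ X (tt_prod a b) (rel_comp X (conv (rel g)) (rel f)).
Proof.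
move=> Z c u v; have [x [y ->]] := prod_elt u; have [x' [y' ->]] := prod_elt v.
move=> h /tt_prodE; norm => -[h1 h2]; decomp h as z h3 h4.
apply: rel_comp_intro (funrel_left (rel_funrel f) h1 h3) _; norm.
exact: (funrel_left (rel_funrel g) h2 h4).
Qed.

Lemma pullback_conditions_exist a b e (f : Hom a e) (g : Hom b e) :
  exists (d : T) (p : Hom d a) (q : Hom d b),
    [/\ f ∘ p = g ∘ q, jointly_monic p q & jointly_full f g p q].
Proof.
pose hk := @pullback_sub _ _ _ f g.
exists (tt_sub hk), (tt_fst a b ∘ tt_incl hk), (tt_snd a b ∘ tt_incl hk); split.
- apply: rel_ext => Z c u z; have [x [y ->]] := prod_elt u => h.
  decomp h as x' h0 h4.
  move: h0 => /(proj1 (fst_inclE hk _ _ _ _)) [h1 h2 h3]; decomp h3 as z' h5 h6.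
  have h7 := funrel_left (rel_funrel f) (per_sym h1) h4.
  through y.
    apply/(snd_inclE hk); split=> //; first exact: per_refl_l h1.
  exact: (funrel_right (rel_funrel g) (funrel_single (rel_funrel f) h5 h7) h6).
- apply: jointly_monic_intro => Z c u v x y.
  have [x1 [y1 ->]] := prod_elt u; have [x2 [y2 ->]] := prod_elt v.
  move=> /fst_inclE [h1 h2 h3] /snd_inclE [h4 h5 h6] /fst_inclE [h7 h8 h9] /snd_inclE [h10 h11 h12].
  apply/tt_subE; split=> //; apply/tt_prodE; norm; split.
    exact: per_trans h1 (per_sym h7).
  exact: per_trans h5 (per_sym h11).
- apply: jointly_full_intro => Z c x y z h1 h2.
  have k : c ⊑ rx ⟨x, y⟩ (rel_comp X (conv (rel g)) (rel f)).
    by apply: (rel_comp_intro X h1); norm.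
  have [hx _] := funrel_strict (rel_funrel f) h1.
  have [hy _] := funrel_strict (rel_funrel g) h2.
  apply: (@rel_comp_intro _ _ _ _ _ _ _ _ _ _ ⟨x, y⟩); norm.
    exact/fst_inclE.
  exact/snd_inclE.
Qed.

(** The conditions hold for the pullback constructed from pairs, and the comparison arrows [u] and
    [v] transport them to any other one. *)
Lemma conditions_of_pullback a b d e (f : Hom a e) (g : Hom b e) (p : Hom d a)
    (q : Hom d b) :
  is_pullback f g p q -> jointly_monic p q /\ jointly_full f g p q.
Proof.
move=> [sq up]; have [d0 [p0 [q0 [sq0 jm jf]]]] := pullback_conditions_exist f g.
have [_ up0] := pullback_of_conditions sq0 jm jf.
have [u [[up1 uq] _]] := up0 _ _ _ sq; have [v [[vp vq] _]] := up _ _ _ sq0.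
have vu : v ∘ u = idm d.
  have [w [_ wu]] := up _ _ _ sq; rewrite -(wu _ (conj (comp_idr p) (comp_idr q))).
  by apply: eq_sym; apply: wu; rewrite !comp_assoc vp vq up1 uq.
split.
  apply: jointly_monic_intro => Z c s t x y h1 h2 h3 h4.
  rewrite -up1 in h1 h3; rewrite -uq in h2 h4.
  decomp h1 as s1 k1 k2; decomp h2 as s2 k3 k4; decomp h3 as t1 k5 k6; decomp h4 as t2 k7 k8.
  have k4' := funrel_left (rel_funrel q0) (funrel_single (rel_funrel u) k3 k1) k4.
  have k8' := funrel_left (rel_funrel q0) (funrel_single (rel_funrel u) k7 k5) k8.
  have e1 := jointly_monic_force jm k2 k4' k6 k8'.
  have [_ hs] := funrel_strict (rel_funrel u) k1.
  total (rel_funrel v) hs as w l1.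
  have l2 := funrel_left (rel_funrel v) e1 l1.
  have := comp_intro k1 l1; have := comp_intro k5 l2; rewrite vu => l3 l4.
  exact: per_trans l4 (per_sym l3).
apply: jointly_full_intro => Z c x y z h1 h2.
have h := jointly_full_force jf h1 h2.
decomp h as w k1 k2; rewrite -vp in k1; rewrite -vq in k2.
decomp k1 as t k3 k4; decomp k2 as t' k5 k6.
apply: (rel_comp_intro X (b := t)); norm=> //.
exact: (funrel_left (rel_funrel q) (funrel_single (rel_funrel v) k5 k3) k6).
Qed.

Definition injective_rel a b (m : Hom a b) : Prop :=
  forall (Z : R) (c : fib R Z) u v x,
    c ⊢ (rel m) [u, x] -> c ⊢ (rel m) [v, x] -> c ⊢ (tt_eq a) [u, v].

(** A mono has the identities as its kernel pair, and [jointly_full] for that square is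
    injectivity. *)
Lemma mono_injective a b (m : Hom a b) : is_mono m <-> injective_rel m.
Proof.
split=> [mm|inj].
  have pbk : is_pullback m m (idm a) (idm a).
    split=> // z s t /mm <-; exists s; split; first by rewrite comp_idl.
    by move=> s'; rewrite comp_idl => -[].
  have [_ jf] := conditions_of_pullback pbk.
  move=> Z c u v x h1 h2; have h := jointly_full_force jf h1 h2.
  by decomp h as w k1 k2; apply: per_trans (per_sym k1) k2.
move=> d f g e; apply: rel_ext => Z c u x h.
have [_ hx] := funrel_strict (rel_funrel f) h.
total (rel_funrel m) hx as y h1.
have k := comp_eq e h h1; decomp k as x' k1 k2.
exact: (funrel_right (rel_funrel g) (inj _ _ _ _ _ k2 h1) k1).
Qed.

Lemma pullback_exists a b e (f : Hom a e) (g : Hom b e) :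
  exists d : {d : T & (Hom d a * Hom d b)%type},
    is_pullback f g (fst (projT2 d)) (snd (projT2 d)).
Proof.
have [d [p [q [sq jm jf]]]] := pullback_conditions_exist f g.
by exists (existT _ d (p, q)); apply: pullback_of_conditions.
Qed.

Definition tt_lim : FinLimits T.
Proof.
pose P a b e (f : Hom a e) (g : Hom b e) :=
  constructive_indefinite_description _ (pullback_exists f g).
exact: (@MkFinLimits T (tt_one X) (terminal_of_conditions (tt_one_conditions X))
  (@tt_prod R X) (@tt_fst R X) (@tt_snd R X) (@tt_pair R X) (@tt_pair_fst R X)
  (@tt_pair_snd R X) (@tt_pair_eta R X) _ _ _ (fun a b e f g => proj2_sig (P a b e f g))).
Defined.

Definition im a b (r : Hom a b) : fib R (tt_car b) := ex X π2 (rel r).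

Lemma im_intro a b (r : Hom a b) (Z : R) (c : fib R Z) x u :
  c ⊢ (rel r) [x, u] -> c ⊑ rx u (im r).
Proof. by move=> h; have := ex_intro_rx X π2 h; rewrite pairE2. Qed.

Lemma im_elim a b (r : Hom a b) (Z : R) (c k : fib R Z) u :
  c ⊑ rx u (im r) ->
  (forall (Y : R) (s : Hom Y Z) x (c' : fib R Y), c' ⊑ rx s c ->
     c' ⊢ (rel r) [x, u ∘ s] -> c' ⊑ rx s k) -> c ⊑ k.
Proof.
move=> h l; apply: (ex_elim h) => Y s v c' e l1 l2.
by apply: (l Y s (π1 ∘ v)) => //; rewrite -e pair_eta.
Qed.

Lemma im_sub a b (r : Hom a b) : is_sub (im r).
Proof.
move=> Z c u v h e; apply: (im_elim h) => Y s x c' l k; push l.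
exact: im_intro (funrel_right (rel_funrel r) e k).
Qed.

(** Replaces the pullback squares in the definition of power objects by two entailments between the
    image of [r] and the preimage of [k], convenient both for proving that an arrow classifies and
    for proving that it is unique. *)
Lemma sub_pullback a b d (k : fib R (tt_car d)) (hk : is_sub k) (r : Hom a b) (g : Hom b d) :
  is_mono r ->
  (exists s, is_pullback (tt_incl hk) g s r) <->
  (forall (Z : R) (c : fib R Z) u v, c ⊢ (rel g) [u, v] -> c ⊑ rx v k -> c ⊑ rx u (im r)) /\
  (forall (Z : R) (c : fib R Z) x u v,
     c ⊢ (rel r) [x, u] -> c ⊢ (rel g) [u, v] -> c ⊑ rx v k).
Proof.
move=> /mono_injective mr; split=> [[s pbk]|[h1 h2]].
  have [jm jf] := conditions_of_pullback pbk; have [sq _] := pbk; split.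
    move=> Z c u v h hv; have [_ e] := funrel_strict (rel_funrel g) h.
    have h' : c ⊢ (rel (tt_incl hk)) [v, v] by view.
    have l := jointly_full_force jf h' h.
    decomp l as x l1 l2; exact: im_intro l2.
  move=> Z c x u v h l; have := comp_intro h l; rewrite -sq => m.
  by decomp m as w m1 m2; view_in m2; case: m2 => m2 m3; exact: (hk _ _ _ _ m3 m2).
(* The missing side is [g ∘ r]: its values satisfy [k], so the same relation is functional towards
   the subobject. *)
have F : @is_funrel R X a (tt_sub hk) (rel (g ∘ r)).
  { have G := rel_funrel (g ∘ r).
  have gk (Z : R) (c : fib R Z) x v : c ⊢ (rel (g ∘ r)) [x, v] -> c ⊑ rx v k.
    by move=> h; decomp h as u l1 l2; apply: h2 l1 l2.
  apply: funrel_intro => Z c.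
  - move=> x v h; have [e1 e2] := funrel_strict G h; split=> //; view; split=> //.
    exact: gk h.
  - exact: (funrel_left G).
  - by move=> x v v' h; view_in h; case: h => h _; apply: (funrel_right G).
  - move=> x v v' l1 l2; view; split; first exact: (funrel_single G) l1 l2.
    exact: gk l1.
  - by move=> x h; total G h as v l; apply: total_intro l. }
exists (rel_hom F); apply: pullback_of_conditions.
- apply: rel_ext => Z c x v h; decomp h as w l1 l2; view_in l2.
  exact: (funrel_right (rel_funrel (g ∘ r)) (proj1 l2) l1).
- by apply: jointly_monic_intro => Z c x y u v _ l1 _ l2; apply: mr l1 l2.
- apply: jointly_full_intro => Z c v u w l1 l2; view_in l1; case: l1 => l1 l3.
  have l4 := funrel_right (rel_funrel g) (per_sym l1) l2.
  have l5 := h1 _ _ _ _ l4 l3.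
  refine (im_elim l5 _) => Y s x c' l m; push l.
  apply: (rel_comp_intro X (b := x)); norm=> //.
  exact: (comp_intro m l4).
Qed.

Lemma graph_exists (b d : T) (h : Hom (tt_car b) (tt_car d)) :
  (forall (Z : R) (c : fib R Z) y y',
     c ⊢ (tt_eq b) [y, y'] -> c ⊢ (tt_eq d) [h ∘ y, h ∘ y']) ->
  exists g : Hom b d, rel g = rx ⟨π1, π1⟩ (tt_eq b) ⊓ rx ⟨h ∘ π1, π2⟩ (tt_eq d).
Proof.
set phi := rx ⟨π1, π1⟩ (tt_eq b) ⊓ rx ⟨h ∘ π1, π2⟩ (tt_eq d) => hh.
have phiE (Z : R) (c : fib R Z) y t : c ⊢ phi [y, t] <->
    c ⊢ (tt_eq b) [y, y] /\ c ⊢ (tt_eq d) [h ∘ y, t].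
  by rewrite /phi; norm; apply: le_meet.
clearbody phi.
have cF : @is_funrel R X b d phi.
  { apply: funrel_intro => Z c.
  - move=> y t /phiE [h1 h2]; split=> //; exact: per_refl_r h2.
  - move=> y y' t e /phiE [h1 h2]; apply/phiE; split; first exact: per_refl_r e.
    exact: per_trans (hh _ _ _ _ (per_sym e)) h2.
  - move=> y t t' e /phiE [h1 h2]; apply/phiE; split=> //; exact: per_trans h2 e.
  - move=> y t t' /phiE [h1 h2] /phiE [h3 h4]; exact: per_trans (per_sym h2) h4.
  - move=> y e; apply: (total_intro X (v := h ∘ y)); apply/phiE; split=> //.
    exact: hh. }
by exists (rel_hom cF).
Qed.

End Subobjects.

Tactic Notation "image" constr(H) "as" ident(v) ident(h) :=
  let Y := fresh "Z0" in let s := fresh "stage_map" in let d := fresh "c0" in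
  let l := fresh "stage_le" in
  lazymatch type of H with
  | context [@im ?R ?X ?a ?b ?r] => refine (@im_elim R X a b r _ _ _ _ H _)
  end; intros Y s v d l h; norm_in h; push l.

(** * Power objects in the topos of a tripos *)

Section PowerObjects.
Variables (R : LexDoctrine) (FT : FullTripos R).
Let FO := ft_fo FT.
Let X := fo_ex FO.
Notation T := (tripos_to_topos X).
Implicit Types a b d : T.

(** The formula [∀ v. x(v, s) → y(v, s)] in the free variable [s]. *)
Definition fimp (A S : R) (x y : fib R (A ×[R] S)) : fib R S :=
  all FO π2 (imp (fo_heyting FO _) x y).

Lemma fimp_elim (A S Z : R) (x y : fib R (A ×[R] S)) (c : fib R Z) v s :
  c ⊑ rx s (fimp x y) -> c ⊢ x [v, s] -> c ⊢ y [v, s].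
Proof.
move=> h hx; have l := proj1 (all_adj FO _ _ _) (le_refl (fimp x y)).
have := rx_le ⟨v, s⟩ l; rewrite -rx_comp pairE2 (rx_imp FO) => l2.
apply: le_trans (proj1 (le_imp _ _ _ _) l2); exact/le_meet.
Qed.

Lemma fimp_intro (A S Z : R) (x y : fib R (A ×[R] S)) (c : fib R Z) s :
  (forall (Y : R) (t : Hom Y Z) v (c' : fib R Y), c' ⊑ rx t c ->
     c' ⊢ x [v, s ∘ t] -> c' ⊢ y [v, s ∘ t]) -> c ⊑ rx s (fimp x y).
Proof.
move=> h; have pbk := pb_pullback (lim R) (π2 : Hom (A ×[R] S) S) s.
rewrite /fimp (all_beck_chevalley FO pbk); apply/all_adj.
rewrite (rx_imp FO); apply/le_imp.
set p := pb1 _ _ _ in pbk *; set q := pb2 _ _ _ in pbk *.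
have e : p = ⟨π1 ∘ p, s ∘ q⟩ by rewrite -(proj1 pbk) pair_eta.
rewrite e; apply: h; first exact: meet_lel.
by rewrite -e; apply: meet_ler.
Qed.

Definition saturated (A B : R) (rho : fib R (A ×[R] A)) (mem : fib R (A ×[R] B)) : Prop :=
  (forall (Z : R) (c : fib R Z) x s, c ⊢ mem [x, s] -> c ⊢ rho [x, x]) /\
  (forall (Z : R) (c : fib R Z) x y s, c ⊢ rho [x, y] -> c ⊢ mem [x, s] -> c ⊢ mem [y, s]).

Lemma weak_power_saturated a : exists (S : R) (mem : fib R (tt_car a ×[R] S)),
  saturated (tt_eq a) mem /\
  forall (B : R) (phi : fib R (tt_car a ×[R] B)), saturated (tt_eq a) phi ->
    exists h : Hom B S, phi = rx ⟨π1, h ∘ π2⟩ mem.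
Proof.
have [S [mem w]] := ft_weak_power FT (tt_car a).
(* Membership up to equality of elements. A saturated [phi] is its own saturation, so the arrow
   naming it for [mem] also names it here. *)
exists S, (rel_comp X mem (tt_eq a)); split.
  split=> Z c x.
    by move=> s h; decomp h as y h1 h2; apply: per_refl_l h1.
  move=> y s e h; decomp h as z h1 h2.
  exact: rel_comp_intro (per_trans (per_sym e) h1) h2.
move=> B phi [p1 p2]; have [h e] := w B phi; exists h.
have memE (Z : R) (c : fib R Z) u v : c ⊢ mem [u, h ∘ v] <-> c ⊢ phi [u, v].
  by rewrite e; norm.
apply: le_antisym; apply: rel_le => Z c u v k; last first.
  move: k; norm => k; decomp k as z h1 h2.
  exact: p2 (per_sym h1) (proj1 (memE _ _ _ _) h2).
norm; exact: rel_comp_intro (p1 _ _ _ _ k) (proj2 (memE _ _ _ _) k).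
Qed.

Section Extensional.
Variables (A S : R) (mem : fib R (A ×[R] S)).

(** Extensional equality of names. It turns weak comprehension in the tripos into unique
    comprehension in the topos. *)
Definition ext_eq : fib R (S ×[R] S) :=
  let x := rx ⟨π1, π1 ∘ π2⟩ mem in let y := rx ⟨π1, π2 ∘ π2⟩ mem in
  fimp x y ⊓ fimp y x.

Lemma ext_eq_intro (Z : R) (c : fib R Z) s t :
  (forall (Y : R) (r : Hom Y Z) x (c' : fib R Y), c' ⊑ rx r c ->
     (c' ⊢ mem [x, s ∘ r] <-> c' ⊢ mem [x, t ∘ r])) -> c ⊢ ext_eq [s, t].
Proof.
move=> h; rewrite /ext_eq; norm; apply/le_meet; split; apply: fimp_intro => Y r x c' l.
  by norm => k; apply/h.
by norm => k; apply/h.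
Qed.

Lemma ext_eq_elim (Z : R) (c : fib R Z) s t x :
  c ⊢ ext_eq [s, t] -> (c ⊢ mem [x, s] <-> c ⊢ mem [x, t]).
Proof.
rewrite /ext_eq; norm => /le_meet [h1 h2]; split=> h.
  have := @fimp_elim _ _ _ _ _ _ x _ h1; norm; exact.
have := @fimp_elim _ _ _ _ _ _ x _ h2; norm; exact.
Qed.

Lemma ext_eq_per : is_per ext_eq.
Proof.
apply: per_intro => Z c s t.
  move=> h; apply: ext_eq_intro => Y r x c' l; push l.
  by split=> k; apply/(ext_eq_elim _ h).
move=> u h1 h2; apply: ext_eq_intro => Y r x c' l; push l.
by rewrite (ext_eq_elim _ h1) (ext_eq_elim _ h2).
Qed.

End Extensional.

(** The power object is [S] with extensional equality, and membership is the subobject [mem]. A mono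
    is classified by the graph of an arrow that names its image. *)
Lemma tt_power_objects : has_power_objects (tt_lim X).
Proof.
move=> a; have [S [mem [[ms me] mw]]] := weak_power_saturated a.
pose pa : T := MkTT (ext_eq_per mem).
have hk : @is_sub R X (tt_prod a pa) mem.
  move=> Z c u v; have [x [s ->]] := prod_elt u; have [y [t ->]] := prod_elt v.
  move=> h e; view_in e; case: e => e1 e2.
  exact: (proj1 (ext_eq_elim _ e2) (me _ _ _ _ _ e1 h)).
exists pa, (tt_sub hk), (tt_incl hk); split.
  apply/mono_injective => Z c u v x h1 h2; view_in h1; view_in h2.
  view; split; last by case: h1.
  apply: (@per_trans R (tt_prod a pa) _ _ _ _ _ (proj1 h1)).
  exact: (per_sym (a := tt_prod a pa) (proj1 h2)).
move=> b s r0 mr0.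
change (exists! c : Hom b pa, exists s0 : Hom s (tt_sub hk),
  is_pullback (tt_incl hk) (tt_pair (tt_fst a b) (c ∘ tt_snd a b)) s0 r0).
have [r [-> mr]] : exists r : Hom s (tt_prod a b), r0 = r /\ is_mono r by exists r0.
move: r0 mr0 => _ _.
have pairE (f : Hom b pa) (Z : R) (c : fib R Z) x y x' t :
    c ⊢ (rel (tt_pair (tt_fst a b) (f ∘ tt_snd a b))) [⟨x, y⟩, ⟨x', t⟩] <->
    c ⊢ (tt_eq a) [x, x'] /\ c ⊢ (rel f) [y, t].
  split.
    move=> h; view_in h; case: h => h1 h2; view_in h1; split; first by case: h1.
    decomp h2 as z k1 k2; view_in k1; case: k1 => k1 k3.
    exact: (funrel_left (rel_funrel f) (per_sym k3) k2).
  move=> [h1 h2]; have [e1 e2] := funrel_strict (rel_funrel f) h2.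
  have e3 := per_refl_l h1.
  by view; split; [view | through y => //; view].
have imS : saturated (tt_eq a) (im r : fib R (tt_car a ×[R] tt_car b)).
  split=> Z c x y.
    move=> h; image h as w k.
    have [_ e] := funrel_strict (rel_funrel r) k.
    view_in e; by case: e.
  move=> z e h; image h as w k.
  have [_ e'] := funrel_strict (rel_funrel r) k; view_in e'; case: e' => e1 e2.
  have e3 : c0 ⊢ (tt_eq (tt_prod a b)) [⟨x, z⟩, ⟨y, z⟩] by view.
  exact: im_intro (funrel_right (rel_funrel r) e3 k).
have [h hE] := mw _ _ imS.
have imE (Z : R) (c : fib R Z) x y : c ⊑ rx ⟨x, y⟩ (im r) <-> c ⊢ mem [x, h ∘ y].
  by rewrite hE; norm.
have hh (Z : R) (c : fib R Z) y y' : c ⊢ (tt_eq b) [y, y'] ->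
    c ⊢ (tt_eq pa) [(h : Hom (tt_car b) (tt_car pa)) ∘ y, h ∘ y'].
  move=> e; apply: ext_eq_intro => Y t x c' l; push l.
  have im_le z z' : c' ⊢ (tt_eq b) [z, z'] -> c' ⊢ mem [x, h ∘ z] -> c' ⊢ mem [x, h ∘ z'].
    move=> e' /imE k; have ex := proj1 imS _ _ _ _ k.
    apply/imE; apply: (im_sub (r := r) (u := ⟨x, z⟩) k); view.
    by split.
  by split; apply: im_le => //; apply: per_sym.
have [c0 c0R] := @graph_exists R X b pa h hh.
have c0E (Z : R) (c : fib R Z) y t : c ⊢ (rel c0) [y, t] <->
    c ⊢ (tt_eq b) [y, y] /\ c ⊢ (ext_eq mem) [h ∘ y, t].
  by rewrite c0R; norm; apply: le_meet.
exists c0; split.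
  apply/(sub_pullback hk _ mr); split=> Z c.
    move=> u v; have [x [y ->]] := prod_elt u; have [x' [t ->]] := prod_elt v.
    move=> /pairE [h1 /c0E [h2 h3]] h4; apply/imE.
    exact: me (per_sym h1) (proj2 (ext_eq_elim _ h3) h4).
  move=> w u v; have [x [y ->]] := prod_elt u; have [x' [t ->]] := prod_elt v.
  move=> h0 /pairE [h1 /c0E [h2 h3]].
  exact: me h1 (proj1 (ext_eq_elim _ h3) (proj1 (imE _ _ _ _) (im_intro h0))).
(* A competing [c1] relates [y] only to names with the same members as [h y], so extensionality
   identifies it with [c0]. *)
move=> c1 /(sub_pullback hk _ mr) [h1 h2].
apply: eq_sym; apply: rel_ext => Z c y t k; apply/c0E.
have [ey _] := funrel_strict (rel_funrel c1) k; split=> //.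
apply: ext_eq_intro => Y r' x c' l; push l; split.
  move=> /imE k1; have ex := proj1 imS _ _ _ _ k1.
  image k1 as w k2.
  have k3 := proj2 (pairE c1 _ _ x y x _) (conj ex k).
  exact: h2 k2 k3.
move=> k1; have ex := ms _ _ _ _ k1; apply/imE.
have k3 := proj2 (pairE c1 _ _ x y x _) (conj ex k).
exact: h1 k3 k1.
Qed.

Lemma tripos_to_topos_elementary : is_elementary_topos T.
Proof. by exists (tt_lim X); apply: tt_power_objects. Qed.

End PowerObjects.

(** * The embedding of triposes *)

Section Embedding.
Variables (P : LexDoctrine) (X : FullExistential P).
Notation Q := (ex_completion P).
Notation rxQ f x := (@rx Q _ _ f x).

Lemma exc_pr_le (A : P) (x y : fib P A) : exc_pr x ⊑ exc_pr y <-> x ⊑ y.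
Proof. by rewrite exc_le_pr rx_id. Qed.

Lemma exc_pr_top (A : P) : exc_pr (top : fib P A) = top.
Proof.
by apply: exc_ext => -[W w m]; rewrite exc_le_pr rx_top; split=> _; apply: le_top.
Qed.

Lemma exc_pr_meet (A : P) (x y : fib P A) : exc_pr (x ⊓ y) = exc_pr x ⊓ exc_pr y.
Proof. by apply: exc_ext => -[W w m]; rewrite le_meet !exc_le_pr rx_meet le_meet. Qed.

Lemma exc_pr_rx (A B : P) (f : Hom A B) (x : fib P B) : exc_pr (rx f x) = rxQ f (exc_pr x).
Proof. by apply: exc_ext => -[W w m]; rewrite exc_le_rxQ !exc_le_pr rx_comp. Qed.

Definition exc_inv (A : P) (x : fib Q A) : fib P A :=
  ex X (pf_arr (refl_repr x)) (pf_pred (refl_repr x)).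

Lemma exc_inv_adj (A : P) (x : fib Q A) (y : fib P A) :
  exc_inv x ⊑ y <-> x ⊑ exc_pr y.
Proof.
rewrite /exc_inv (ex_adj X) -exc_le_pr.
suff -> : exc_cl (MkPreFib (pf_arr (refl_repr x)) (pf_pred (refl_repr x))) = x by [].
by rewrite -[RHS](exc_repr_cl x); case: (refl_repr x).
Qed.

Lemma exc_inv_pr (A : P) (x : fib P A) : exc_inv (exc_pr x) = x.
Proof. by apply: upper_ext => z; rewrite exc_inv_adj exc_pr_le. Qed.

Lemma exc_inv_unit (A : P) (x : fib Q A) : x ⊑ exc_pr (exc_inv x).
Proof. by apply/exc_inv_adj; apply: le_refl. Qed.

Lemma exc_inv_le (A : P) (x y : fib Q A) : x ⊑ y -> exc_inv x ⊑ exc_inv y.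
Proof. by move=> l; apply/exc_inv_adj; apply: le_trans l _; apply: exc_inv_unit. Qed.

(** Both sides are left adjoint to the same composite, since principal elements commute with
    reindexing. *)
Lemma exc_inv_ex (XQ : FullExistential Q) (A B : P) (f : Hom A B) (x : fib Q A) :
  exc_inv (ex XQ f x) = ex X f (exc_inv x).
Proof.
apply: upper_ext => z.
by rewrite exc_inv_adj (ex_adj XQ) (ex_adj X) exc_inv_adj exc_pr_rx.
Qed.

Let XQ := completion_existential P.

Lemma exc_exE (A : P) (x : fib Q A) : exists (B : P) (f : Hom B A) (m : fib P B),
  x = ex XQ f (exc_pr m).
Proof.
exists _, (pf_arr (refl_repr x)), (pf_pred (refl_repr x)).
by rewrite -[LHS](exc_repr_cl x) exc_clE_ex.
Qed.

Lemma exc_inv_top (A : P) : exc_inv (top : fib Q A) = top.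
Proof. by rewrite -exc_pr_top exc_inv_pr. Qed.

(** On an existential of a principal element, Beck-Chevalley in [Q] and in [P] computes both sides
    to the same existential. *)
Lemma exc_inv_rx (A B : P) (g : Hom A B) (x : fib Q B) :
  exc_inv (rxQ g x) = rx g (exc_inv x).
Proof.
have [C [f [m ->]]] := exc_exE x.
have pbk := pb_pullback (lim P) f g.
rewrite (ex_beck_chevalley XQ pbk) -exc_pr_rx !exc_inv_ex !exc_inv_pr.
by rewrite (ex_beck_chevalley X pbk).
Qed.

Lemma exc_inv_meet (A : P) (x y : fib Q A) : exc_inv (x ⊓ y) = exc_inv x ⊓ exc_inv y.
Proof.
have [B [f [m ->]]] := exc_exE x.
rewrite -(ex_frobenius XQ) !exc_inv_ex exc_inv_pr -(ex_frobenius X) -exc_inv_rx.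
(* Frobenius has made the first argument principal; the same reduction is now applied to the
   second. *)
congr ex; move: (rxQ f y) => {}y.
have [C [g [n ->]]] := exc_exE y.
rewrite meetC -(ex_frobenius XQ) !exc_inv_ex !exc_inv_pr -exc_pr_rx -exc_pr_meet exc_inv_pr.
by rewrite (ex_frobenius X) meetC.
Qed.

Definition pr_mor : LexDoctrineMor P Q.
Proof.
apply: (@MkLexDoctrineMor P Q (functor_id P) _ (fun A x => exc_pr x)) => //.
- exact: exc_pr_meet.
- exact: exc_pr_rx.
Defined.

Definition inv_mor : LexDoctrineMor Q P.
Proof.
apply: (@MkLexDoctrineMor Q P (functor_id P) _ (fun A x => exc_inv x)) => //.
- by move=> A; apply: exc_inv_top.
- exact: exc_inv_meet.
- exact: exc_inv_rx.
Defined.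

Definition inv_pr_unit : TwoCell (doctrine_id Q) (doctrine_comp pr_mor inv_mor).
Proof.
unshelve refine (@MkTwoCell Q Q (doctrine_id Q) (doctrine_comp pr_mor inv_mor)
  (@MkNatTrans Q Q (functor_id Q) (dm_fun (doctrine_comp pr_mor inv_mor))
    (fun A : P => idm A) _) _).
  by move=> A B f; rewrite /= comp_idl comp_idr.
by move=> A x; rewrite [rx _ _](rx_id (l := Q)); apply: exc_inv_unit.
Defined.

Definition inv_pr_counit : TwoCell (doctrine_comp inv_mor pr_mor) (doctrine_id P).
Proof.
unshelve refine (@MkTwoCell P P (doctrine_comp inv_mor pr_mor) (doctrine_id P)
  (@MkNatTrans P P (dm_fun (doctrine_comp inv_mor pr_mor)) (functor_id P)
    (fun A : P => idm A) _) _).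
  by move=> A B f; rewrite /= comp_idl comp_idr.
by move=> A x; rewrite /= rx_id exc_inv_pr; apply: le_refl.
Defined.

Definition inv_pr_adjunction : DoctrineAdjunction inv_mor pr_mor.
Proof.
by refine (@MkDoctrineAdjunction P Q inv_mor pr_mor inv_pr_unit inv_pr_counit _ _)
  => A; rewrite /= comp_idl.
Defined.

Lemma inv_pr_counit_invertible : is_invertible_2cell (d_counit inv_pr_adjunction).
Proof.
unshelve eexists.
  unshelve refine (@MkTwoCell P P (doctrine_id P) (doctrine_comp inv_mor pr_mor)
    (@MkNatTrans P P (functor_id P) (dm_fun (doctrine_comp inv_mor pr_mor))
    (fun A : P => idm A) _) _).
    by move=> A B f; rewrite /= comp_idl comp_idr.
  by move=> A x; rewrite /= rx_id exc_inv_pr; apply: le_refl.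
by split=> A; rewrite /= comp_idl.
Qed.

End Embedding.

(** * The embedding of toposes *)

(** Chosen universal arrows from [L] assemble into a right adjoint with counit [e], so invertible
    universal arrows give an embedding. *)
Lemma embedding_of_universal (E F : Topos) (L : Functor F E) :
  preserves_finite_limits L ->
  (forall a : E, exists (g : F) (e : Hom (L g) a), is_iso e /\
     forall (b : F) (f : Hom (L b) a), exists! h : Hom b g, e ∘ fmap L h = f) ->
  exists g : ToposGeometricMorphism E F, is_topos_embedding g.
Proof.
move=> lex univ.
pose U a := constructive_indefinite_description _ (univ a).
pose G a : F := proj1_sig (U a).
pose V a := constructive_indefinite_description _ (proj2_sig (U a)).
pose e a : Hom (L (G a)) a := proj1_sig (V a).
have eiso a : is_iso (e a) := proj1 (proj2_sig (V a)).
pose W b a (f : Hom (L b) a) :=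
  constructive_indefinite_description _ (proj2 (proj2_sig (V a)) b f).
pose lift b a (f : Hom (L b) a) : Hom b (G a) := proj1_sig (W b a f).
have liftE b a (f : Hom (L b) a) : e a ∘ fmap L (lift b a f) = f := proj1 (proj2_sig (W b a f)).
have ext b a (h k : Hom b (G a)) : e a ∘ fmap L h = e a ∘ fmap L k -> h = k.
  move=> hk; have u := proj2 (proj2_sig (W b a (e a ∘ fmap L k))).
  exact: (eq_trans (eq_sym (u h hk)) (u k eq_refl)).
clearbody lift e G.
unshelve refine (let D : Functor E F :=
  @MkFunctor E F G (fun a b f => lift _ _ (f ∘ e a)) _ _ in _).
{ by move=> a; apply: ext; rewrite liftE fmap_id comp_idl comp_idr. }
{ move=> a b d g f; apply: ext; rewrite fmap_comp comp_assoc !liftE.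
  by rewrite -!comp_assoc liftE. }
unshelve refine (ex_intro _ (@MkToposGeometricMorphism E F D L lex
  (@MkNatTrans F F (functor_id F) (functor_comp D L) (fun b => lift _ _ (idm (L b))) _)
  (@MkNatTrans E E (functor_comp L D) (functor_id E) e _) _ _) _) => /=.
- move=> a b f; apply ext; rewrite !fmap_comp !comp_assoc !liftE.
  by rewrite comp_idl -comp_assoc liftE comp_idr.
- by move=> a b f; rewrite liftE.
- by move=> b; rewrite liftE.
- move=> a; apply ext; rewrite fmap_comp comp_assoc liftE -comp_assoc liftE.
  by rewrite fmap_id comp_idr.
- by move=> a; exact (eiso a).
Qed.

Section Graph.
Variables (R : LexDoctrine) (X : FullExistential R).
Notation T := (tripos_to_topos X).

(** The converse relation is functional and is the inverse. *)
Lemma iso_of_bijective (a b : T) (f : Hom a b) : injective_rel f ->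
  tt_eq b ⊑ rel_comp X (rel f) (conv (rel f)) -> is_iso f.
Proof.
move=> inj sur; have F := rel_funrel f.
have G : @is_funrel R X b a (conv (rel f)).
  { apply: funrel_intro => Z c.
  - move=> y x; norm => h; by have [? ?] := funrel_strict F h.
  - move=> y y' x e; norm; exact: (funrel_right F).
  - move=> y x x' e; norm; exact: (funrel_left F).
  - by move=> y x x'; norm; apply: inj.
  - move=> y e; have h := force_le sur e; decomp h as x h1 h2.
    by apply: (total_intro X (v := x)); norm. }
exists (rel_hom G); split; apply: rel_ext => Z c u v h.
  decomp h as y h1 h2; move: h2; rewrite /rel /=; norm; exact: inj h1.
decomp h as x h1 h2; move: h1; rewrite /rel /=; norm => h1; exact: (funrel_single F h1 h2).
Qed.

End Graph.

(** * Singletons and names of single-valued relations *)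

Section Singletons.
Variables (R : LexDoctrine) (FT : FullTripos R).
Let X := fo_ex (ft_fo FT).
Notation T := (tripos_to_topos X).

(** [phi] is a functional relation towards [a], with no condition on its source. *)
Record single_valued (a : T) (B : R) (phi : fib R (B ×[R] tt_car a)) : Prop :=
  MkSingleValued {
    sv_strict : forall (Z : R) (c : fib R Z) s x, c ⊢ phi [s, x] -> c ⊢ (tt_eq a) [x, x];
    sv_right : forall (Z : R) (c : fib R Z) s x y,
      c ⊢ (tt_eq a) [x, y] -> c ⊢ phi [s, x] -> c ⊢ phi [s, y];
    sv_single : forall (Z : R) (c : fib R Z) s x y,
      c ⊢ phi [s, x] -> c ⊢ phi [s, y] -> c ⊢ (tt_eq a) [x, y]
  }.

(** [chi (s, x)] says that [x] belongs to [s] and equals every member of [s]. The fibres of a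
    single-valued [phi] have this form, so an arrow naming them as subsets also represents [phi]
    through [chi]. *)
Lemma singletons_exist (a : T) : exists (S : R) (chi : fib R (S ×[R] tt_car a)),
  single_valued chi /\
  forall (B : R) (phi : fib R (B ×[R] tt_car a)), single_valued phi ->
    exists h : Hom B S, forall (Z : R) (c : fib R Z) b x,
      c ⊢ phi [b, x] <-> c ⊢ chi [h ∘ b, x].
Proof.
have [S [mem [[ms me] mw]]] := @weak_power_saturated R FT a.
pose u : fib R (tt_car a ×[R] (S ×[R] tt_car a)) := rx ⟨π1, π1 ∘ π2⟩ mem.
pose v : fib R (tt_car a ×[R] (S ×[R] tt_car a)) := rx ⟨π2 ∘ π2, π1⟩ (tt_eq a).
have chi_in (Z : R) (c : fib R Z) s x : c ⊢ mem [x, s] ->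
    (forall (Y : R) (t : Hom Y Z) y (c' : fib R Y), c' ⊑ rx t c ->
       c' ⊢ mem [y, s ∘ t] -> c' ⊢ (tt_eq a) [x ∘ t, y]) ->
    c ⊢ (conv mem ⊓ fimp FT u v) [s, x].
  move=> h k; norm; apply/le_meet; split=> //; apply: fimp_intro => Y t y c' l.
  by rewrite /u /v; norm; apply: k.
have chi_out (Z : R) (c : fib R Z) s x : c ⊢ (conv mem ⊓ fimp FT u v) [s, x] ->
    c ⊢ mem [x, s] /\ (forall y, c ⊢ mem [y, s] -> c ⊢ (tt_eq a) [x, y]).
  norm => /le_meet [h1 h2]; split=> // y k.
  by have := fimp_elim (v := y) h2; rewrite /u /v; norm; apply.
move: (conv mem ⊓ fimp FT u v) chi_in chi_out => chi chi_in chi_out.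
exists S, chi; split.
  { split=> Z c s x.
  - by move=> /chi_out [h _]; apply: ms h.
  - move=> y e h; have [h1 _] := chi_out _ _ _ _ h; apply: chi_in; first exact: me e h1.
    move=> Y t z c' l k; push l; have [_ h2] := chi_out _ _ _ _ h.
    exact: per_trans (per_sym e) (h2 z k).
  - by move=> y /chi_out [h1 h2] /chi_out [h3 _]; apply: h2. }
move=> B phi sv.
have cs : saturated (tt_eq a) (conv phi).
  split=> Z c x y; first by norm; apply: (sv_strict sv).
  by move=> z e; norm; apply: (sv_right sv).
have [h e] := mw _ _ cs; exists h => Z c b x.
have E (Z' : R) (c' : fib R Z') b' x' : c' ⊢ phi [b', x'] <-> c' ⊢ mem [x', h ∘ b'].
  by rewrite -(convE phi) e; norm.
split=> [k|/chi_out [k _]]; last exact/E.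
apply: chi_in; first exact/E.
move=> Y t y c' l; push l; rewrite -E; exact: (sv_single sv k).
Qed.

End Singletons.

Lemma force_single (R : LexDoctrine) (A B : R) (m : fib R (A ×[R] B)) (e : fib R (B ×[R] B)) :
  rx ⟨π1 ∘ π1, π2 ∘ π1⟩ m ⊓ rx ⟨π1 ∘ π1, π2⟩ m ⊑
    (rx ⟨π2 ∘ π1, π2⟩ e : fib R (A ×[R] B ×[R] B)) ->
  forall (Z : R) (c : fib R Z) y t t', c ⊢ m [y, t] -> c ⊢ m [y, t'] -> c ⊢ e [t, t'].
Proof.
move=> h Z c y t t' h1 h2; have := rx_le ⟨⟨y, t⟩, t'⟩ h.
by norm; apply: le_trans; apply/le_meet.
Qed.

(** * The inverse image functor and its universal arrows *)

Section ToposEmbedding.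
Variables (P : LexDoctrine) (FT : FullTripos P) (XQ : FullExistential (ex_completion P)).
Let X := fo_ex (ft_fo FT).
Notation Q := (ex_completion P).
Notation rxQ f x := (@rx Q _ _ f x).
Notation TP := (tripos_to_topos X).
Notation TQ := (tripos_to_topos XQ).
Notation inv := (exc_inv X).

Lemma inv_le_rx (A B : P) (f : Hom A B) (x : fib Q A) (y : fib Q B) :
  x ⊑ rxQ f y -> inv x ⊑ rx f (inv y).
Proof. by move=> /(exc_inv_le X); rewrite exc_inv_rx. Qed.

(** The common shape of transitivity and of the left, right and single-valuedness conditions on
    functional relations. *)
Lemma inv_rx2_le (A B B' C : P) (f : Hom A B) (g : Hom A B') (h : Hom A C) (x : fib Q B)
    (y : fib Q B') (z : fib Q C) :
  rxQ f x ⊓ rxQ g y ⊑ rxQ h z -> rx f (inv x) ⊓ rx g (inv y) ⊑ rx h (inv z).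
Proof. by move=> /(exc_inv_le X); rewrite exc_inv_meet !exc_inv_rx. Qed.

Lemma inv_per (A : P) (rho : fib Q (A ×[P] A)) : @is_per Q A rho -> is_per (inv rho).
Proof. by move=> [h1 h2]; split; [apply: inv_le_rx h1 | apply: inv_rx2_le h2]. Qed.

Lemma pr_le_rx (A B : P) (f : Hom A B) (x : fib P A) (y : fib P B) :
  x ⊑ rx f y -> exc_pr x ⊑ rxQ f (exc_pr y).
Proof. by move=> /exc_pr_le; rewrite exc_pr_rx. Qed.

Lemma pr_rx2_le (A B B' C : P) (f : Hom A B) (g : Hom A B') (h : Hom A C) (x : fib P B)
    (y : fib P B') (z : fib P C) :
  rx f x ⊓ rx g y ⊑ rx h z -> rxQ f (exc_pr x) ⊓ rxQ g (exc_pr y) ⊑ rxQ h (exc_pr z).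
Proof. by move=> /exc_pr_le; rewrite exc_pr_meet !exc_pr_rx. Qed.

Lemma pr_per (A : P) (rho : fib P (A ×[P] A)) : is_per rho -> @is_per Q A (exc_pr rho).
Proof. by move=> [h1 h2]; split; [apply: pr_le_rx h1 | apply: pr_rx2_le h2]. Qed.

Definition inv_ob (a : TQ) : TP := MkTT (inv_per (tt_per a)).

Lemma inv_funrel (a b : TQ) phi : @is_funrel Q XQ a b phi ->
  @is_funrel P X (inv_ob a) (inv_ob b) (inv phi).
Proof.
move=> [h1 h2 h3 h4 h5]; split.
- by have := exc_inv_le X h1; rewrite exc_inv_meet !exc_inv_rx.
- exact: inv_rx2_le h2.
- exact: inv_rx2_le h3.
- exact: inv_rx2_le h4.
- by have := exc_inv_le X h5; rewrite exc_inv_ex exc_inv_rx.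
Qed.

Lemma inv_rel_comp (A B C : P) (psi : fib Q (B ×[P] C)) (phi : fib Q (A ×[P] B)) :
  inv (@rel_comp Q XQ A B C psi phi) = rel_comp X (inv psi) (inv phi).
Proof. by rewrite /rel_comp exc_inv_ex exc_inv_meet !exc_inv_rx. Qed.

Definition inv_fun : Functor TQ TP.
Proof.
apply: (@MkFunctor TQ TP inv_ob (fun a b f => rel_hom (inv_funrel (rel_funrel f)))).
- by move=> a; apply: tt_hom_eq.
- by move=> a b d g f; apply: tt_hom_eq; apply: inv_rel_comp.
Defined.

Lemma inv_conv (A B : P) (x : fib Q (A ×[P] B)) : inv (@conv Q A B x) = conv (inv x).
Proof. exact: exc_inv_rx. Qed.

Lemma inv_fun_lex : preserves_finite_limits inv_fun.
Proof.
split=> [t /conditions_of_terminal [h1 h2]|a b e f g d p q pbk].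
  apply: terminal_of_conditions; split.
    by have := exc_inv_le X h1; rewrite exc_inv_meet !exc_inv_rx.
  by move=> b; have := exc_inv_le X (h2 b); rewrite exc_inv_top exc_inv_ex exc_inv_rx.
have [jm jf] := conditions_of_pullback pbk.
apply: pullback_of_conditions.
- by rewrite -!fmap_comp (proj1 pbk).
- have := exc_inv_le X jm; rewrite exc_inv_meet; rewrite !inv_rel_comp.
  by rewrite !inv_conv.
- by have := exc_inv_le X jf; rewrite !inv_rel_comp !inv_conv.
Qed.

(** Both relations lie below [exc_pr] of their common image, which is single-valued for the
    principal equality [exc_pr rho]. Hence their values agree. *)
Lemma inv_fun_faithful_pr (b : TQ) (S : P) (rho : fib P (S ×[P] S)) (hr : is_per rho)
    (g1 g2 : @Hom TQ b (MkTT (pr_per hr))) :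
  fmap inv_fun g1 = fmap inv_fun g2 -> g1 = g2.
Proof.
move=> e12; have s := pr_rx2_le (fr_single (rel_funrel (fmap inv_fun g1))).
have l1 : rel g1 ⊑ exc_pr (rel (fmap inv_fun g1)) by apply: exc_inv_unit.
have l2 : rel g2 ⊑ exc_pr (rel (fmap inv_fun g1)) by rewrite e12; apply: exc_inv_unit.
apply: rel_ext => Z c y t k.
have [ey _] := funrel_strict (rel_funrel g1) k.
total (rel_funrel g2) ey as t' k'.
apply: (funrel_right (rel_funrel g2) _ k').
have e : exc_pr (tt_eq (inv_fun (MkTT (pr_per hr)))) = exc_pr rho by rewrite /= exc_inv_pr.
rewrite e in s; apply: (force_single (R := Q) s).
  exact: le_trans k' (@rx_le Q _ _ _ _ _ l2).
exact: le_trans k (@rx_le Q _ _ _ _ _ l1).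
Qed.

Lemma inv_fun_universal (a : TP) : exists (g : TQ) (e : Hom (inv_fun g) a), is_iso e /\
  forall (b : TQ) (f : Hom (inv_fun b) a), exists! h : Hom b g, e ∘ fmap inv_fun h = f.
Proof.
have [S [chi [sv univ]]] := singletons_exist a.
(* The kernel of [chi]: two names are equal when they share a value. This makes [chi] injective by
   construction. *)
pose rho := rel_comp X (conv chi) chi.
have rho_in (Z : P) (c : fib P Z) s t x : c ⊢ chi [s, x] -> c ⊢ chi [t, x] -> c ⊢ rho [s, t].
  by move=> h1 h2; apply: (rel_comp_intro X h1); norm.
have hr : is_per rho.
  apply: per_intro => Z c s t.
    by move=> h; decomp h as x h1 h2; apply: rho_in h2 h1.
  move=> u h1 h2; decomp h1 as x k1 k2; decomp h2 as y k3 k4.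
  exact: rho_in k1 (sv_right sv (sv_single sv k3 k2) k4).
pose g : TQ := MkTT (pr_per hr).
have eqE : tt_eq (inv_fun g) = rho by rewrite /= exc_inv_pr.
have F : @is_funrel P X (inv_fun g) a chi.
  { apply: funrel_intro; rewrite ?eqE => Z c.
  - move=> s x h; split; first exact: (rho_in _ _ _ _ _ h h).
    exact: (sv_strict sv h).
  - move=> s s' x h1 h2; decomp h1 as y k1 k2.
    exact: (sv_right sv (sv_single sv k1 h2) k2).
  - by move=> s x x'; apply: (sv_right sv).
  - by move=> s x x'; apply: (sv_single sv).
  - move=> s h; decomp h as x k1 k2; exact: total_intro k1. }
pose e := rel_hom F.
have eiso : is_iso e.
  apply: iso_of_bijective.
    move=> Z c s t x; rewrite eqE; exact: rho_in.
  (* Surjectivity: the equality of [a] is itself single-valued, so every existing [x] has a name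
     [h x]. *)
  have sa : single_valued (tt_eq a).
    split=> Z c s x; first exact: per_refl_r.
      by move=> y h k; apply: per_trans k h.
    by move=> y h k; apply: per_trans (per_sym h) k.
  have [h hE] := univ _ _ sa.
  apply: rel_le => Z c x y k; apply: (rel_comp_intro X (b := h ∘ x)).
    by norm; apply/hE; apply: per_refl_l k.
  exact/hE.
exists g, e; split=> // b f.
have sf : single_valued (rel f).
  split=> Z c s x; first by move=> /(funrel_strict (rel_funrel f)) [].
    by move=> y; apply: (funrel_right (rel_funrel f)).
  by move=> y; apply: (funrel_single (rel_funrel f)).
have [h hE] := univ _ _ sf.
have rho_force (Z : P) (c : fib P Z) (y y' : Hom Z (tt_car (inv_fun b))) :
    c ⊢ (tt_eq (inv_fun b)) [y, y'] -> c ⊢ rho [h ∘ y, h ∘ y'].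
  move=> k0; total (rel_funrel f) (per_refl_l k0) as x k1.
  have k2 := funrel_left (rel_funrel f) k0 k1.
  by apply: rho_in; apply/hE; eassumption.
have hh : inv (tt_eq b) ⊑ rx ⟨h ∘ π1, h ∘ π2⟩ rho.
  apply: rel_le => Z c y0 y0' k0; norm; move: k0.
  move: y0 y0' => y y' k; have k1 : c ⊢ (tt_eq (inv_fun b)) [y, y'] := k.
  apply: (rho_force _ _ y y' k1).
(* Since the equality on [g] is principal, the adjunction moves preservation of equality by [h] from
   [P] to [Q], where [h] then has a graph. *)
have l : tt_eq b ⊑ rxQ ⟨h ∘ π1, h ∘ π2⟩ (exc_pr rho).
  by rewrite -[rxQ _ _]exc_pr_rx; apply/(exc_inv_adj X).
have lh (Z : Q) (c : fib Q Z) (y y' : Hom Z (tt_car b)) :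
    c ⊢ (tt_eq b) [y, y'] -> c ⊢ (tt_eq g) [(h : Hom (tt_car b) (tt_car g)) ∘ y, h ∘ y'].
  move=> /(force_le (R := Q) l); rewrite -[rx _ (rx _ _)](rx_comp (l := Q)) (pair_comp (P := Q)).
  by rewrite -!comp_assoc !(pairE1 (R := Q)) !(pairE2 (R := Q)).
have [g0 g0E] := @graph_exists Q XQ b g h lh.
have g0F : inv (rel g0) = rx ⟨π1, π1⟩ (inv (tt_eq b)) ⊓ rx ⟨h ∘ π1, π2⟩ rho.
  by rewrite g0E exc_inv_meet !exc_inv_rx exc_inv_pr.
have g0R (Z : P) (c : fib P Z) (y : Hom Z (tt_car (inv_fun b))) (s : Hom Z S) :
    c ⊢ (inv (rel g0)) [y, s] -> c ⊢ rho [h ∘ y, s].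
  move=> k; have := force_le (eq_ind _ (fun z => z ⊑ _) (meet_ler _ _) _ (eq_sym g0F)) k.
  by norm.
have ef : e ∘ fmap inv_fun g0 = f.
  apply: rel_ext => Z c y x k; decomp k as s k1 k2; apply/hE.
  have k3 := g0R _ _ _ _ k1; decomp k3 as x' k4 k5.
  exact: (sv_right sv (sv_single sv k5 k2) k4).
(* Cancelling the isomorphism [e] leaves two arrows with equal images under [inv_fun]. *)
exists g0; split=> // g1 eg1; apply: inv_fun_faithful_pr.
have [e' [ee' _]] := eiso.
by rewrite -[LHS]comp_idl -[RHS]comp_idl -ee' -!comp_assoc eg1 ef.
Qed.

End ToposEmbedding.

Theorem theorem8p1 :
  forall (P : Tripos), ex_supercompactifiable P ->
  exists PE : FullTripos (ex_completion P),
    let Pex := MkTripos PE in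
    (exists g : TriposGeometricMorphism P Pex, is_tripos_embedding g) /\
    (exists (tP : is_elementary_topos (tripos_to_topos (tripos_ex P)))
            (tPex : is_elementary_topos (tripos_to_topos (tripos_ex Pex)))
            (g : ToposGeometricMorphism (MkTopos tP) (MkTopos tPex)),
       is_topos_embedding g).
Proof.
move=> P [wdp gp]; have [PE _] := completion_tripos wdp gp; exists PE => Pex; split.
  exists (@MkTriposGeometricMorphism P Pex _ _ (inv_pr_adjunction (tripos_ex P))).
  exact: inv_pr_counit_invertible.
exists (tripos_to_topos_elementary (tripos_axiom P)), (tripos_to_topos_elementary PE).
refine (@embedding_of_universal (MkTopos _) (MkTopos _) _
  (@inv_fun_lex P (tripos_axiom P) (tripos_ex Pex)) _).
exact: inv_fun_universal.
Qed.
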